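(* Let $\mathcal T=(\mathcal S,\to)$ be a timed transition system of timed sort $\Sigma$ and $\mathcal V$ a valuation, and let $S\subseteq\mathcal S$ and a timed mu-calculus formula $\Phi$ in positive normal form be such that $S\subseteq[\![\Phi]\!]_{\mathcal V}$. Then the sequent $S\vdash^{\mathcal T}_{\mathcal V,\varepsilon}\Phi$ ($\varepsilon$ the empty definition list) has a successful timed tableau.
   Context: A timed sort is a set $\Sigma$ with $\mathbb R_{\ge0}\subseteq\Sigma$; $\mathrm{Var}$ is a countably infinite set of variables. A TTS is an LTS $(\mathcal S,\to)$, ${\to}\subseteq\mathcal S\times\Sigma\times\mathcal S$, such that for all $s,s',s''$ and $\delta,\delta'\ge0$: $s\xrightarrow{0}s$; $s\xrightarrow{\delta}s'$ and $s\xrightarrow{\delta}s''$ imply $s'=s''$; $s\xrightarrow{\delta}s'\xrightarrow{\delta'}s''$ implies $s\xrightarrow{\delta+\delta'}s''$; if $s\xrightarrow{\delta}s'$ and $\delta=\delta'+\delta''$ ($\delta',\delta''\ge0$) then $s\xrightarrow{\delta'}s''\xrightarrow{\delta''}s'$ for some $s''$. $s\xrightarrow{K}s'$ means $s\xrightarrow{a}s'$ for some $a\in K$. $\mathrm{succ}(s,\delta)$ is the unique $s'$ with $s\xrightarrow{\delta}s'$; $\mathrm{delays}(s)=\{\delta\ge0\mid\exists s'.\ s\xrightarrow{\delta}s'\}$; $\mathrm{succ}_<(s,\delta)=\{s'\mid\exists\delta'<\delta.\ s\xrightarrow{\delta'}s'\}$. Valuation $\mathcal V:\mathrm{Var}\to2^{\mathcal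 S}$. Timed formulas: $\Phi::=Z\mid\neg\Phi\mid\Phi_1\wedge\Phi_2\mid[K]\Phi\mid\forall_{\Phi_1}(\Phi_2)\mid\nu Z.\Phi$, with $Z$ positive in $\Phi$ in every $\nu Z.\Phi$. Derived: $\vee$, $\langle K\rangle\Phi=\neg[K]\neg\Phi$, $\mu Z.\Phi=\neg\nu Z.\neg\Phi[Z:=\neg Z]$, $\exists_{\Phi_1}(\Phi_2)=\neg\forall_{\neg\Phi_1}(\neg\Phi_2)$. Semantics: $[\![Z]\!]_{\mathcal V}=\mathcal V(Z)$, negation = complement, $\wedge$ = intersection, $[\![[K]\Phi]\!]_{\mathcal V}=\{s\mid\forall s'.\ s\xrightarrow{K}s'\Rightarrow s'\in[\![\Phi]\!]_{\mathcal V}\}$, $[\![\nu Z.\Phi]\!]_{\mathcal V}=\bigcup\{S'\mid S'\subseteq[\![\Phi]\!]_{\mathcal V[Z:=S']}\}$, $[\![\forall_{\Phi_1}(\Phi_2)]\!]_{\mathcal V}=\{s\mid\forall\delta\in\mathrm{delays}(s).\ \mathrm{succ}_<(s,\delta)\cap[\![\Phi_1]\!]_{\mathcal V}=\emptyset\Rightarrow\mathrm{succ}(s,\delta)\in[\![\Phi_2]\!]_{\mathcal V}\}$. Positive normal form: built from $Z,\neg Z,\wedge,\vee,[K],\langle K\rangle,\forall,\exists,\nu,\mu$. Definition lists $\Delta=(U_1=\Phi_1)\cdots(U_n=\Phi_n)$: distinct $U_i$, no $U_i$ bound in any $\Phi_j$, $U_j$ not free in $\Phi_i$ for $i\le j$.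 Sequent $S\vdash^{\mathcal T}_{\mathcal V,\Delta}\Phi$: $S\subseteq\mathcal S$, $\Phi$ in positive normal form, each $U\in\mathrm{dom}(\Delta)$ positive and not bound in $\Phi$. Rules (conclusion; premises): ($\wedge$) $S\vdash_\Delta\Phi_1\wedge\Phi_2$; $S\vdash_\Delta\Phi_1$, $S\vdash_\Delta\Phi_2$. ($\vee$) $S\vdash_\Delta\Phi_1\vee\Phi_2$; $S_1\vdash_\Delta\Phi_1$, $S_2\vdash_\Delta\Phi_2$, $S=S_1\cup S_2$. ($[K]$) $S\vdash_\Delta[K]\Phi$; $\{s'\mid\exists s\in S.\ s\xrightarrow{K}s'\}\vdash_\Delta\Phi$. ($\langle K\rangle$, witness $f:S\to\mathcal S$, $s\xrightarrow{K}f(s)$) $S\vdash_\Delta\langle K\rangle\Phi$; $f(S)\vdash_\Delta\Phi$. ($\sigma Z$) $S\vdash_\Delta\sigma Z.\Phi$; $S\vdash_{\Delta\cdot(U=\sigma Z.\Phi)}U$, $U$ fresh. (Un) $S\vdash_\Delta U$; $S\vdash_\Delta\Phi[Z:=U]$, $\Delta(U)=\sigma Z.\Phi$. (Thin) $S\vdash_\Delta\Phi$; $S'\vdash_\Delta\Phi$, $S\subseteq S'$. ($\exists$, $f:S\to\mathbb R_{\ge0}$, $f(s)\in\mathrm{delays}(s)$) $S\vdash_\Delta\exists_{\Phi_1}(\Phi_2)$; $f_<(S)\vdash_\Delta\Phi_1$, $f_=(S)\vdash_\Delta\Phi_2$, with $f_<(S)=\bigcup_{s\in S}\mathrm{succ}_<(s,f(s))$,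 $f_=(S)=\{\mathrm{succ}(s,f(s))\mid s\in S\}$. ($\forall$, $g$ with $g(s,\delta)\le\delta$ defined for all $s\in S$, $\delta\in\mathrm{delays}(s)$) $S\vdash_\Delta\forall_{\Phi_1}(\Phi_2)$; $g_<(S)\vdash_\Delta\Phi_1$, $g_=(S)\vdash_\Delta\Phi_2$, with $g_<(S)=\{\mathrm{succ}(s,g(s,\delta))\mid s\in S,\delta\in\mathrm{delays}(s),g(s,\delta)<\delta\}$ and $g_=(S)$ likewise with $g(s,\delta)=\delta$. A timed tableau is a finite nonempty ordered tree of nodes labelled by sequents over $\mathcal T,\mathcal V$, each internal node labelled by a rule application (plus $f$ or $g$ for $\langle K\rangle,\exists,\forall$) forming an instance of the rule with its ordered children, with root definition list empty and terminal leaves $n$ (sequent $S_n\vdash_\Delta\Phi$): (a) $\Phi\in\{Z,\neg Z\}$, $Z\notin\mathrm{dom}(\Delta)$; (b) $\Phi=\langle K\rangle\Psi$ and some $s\in S_n$ has no $K$-successor; (c) $\Phi=U\in\mathrm{dom}(\Delta)$ and some strict ancestor $m$ has formula $U$ with $S_n\subseteq S_m$ ($\mu$-/$\nu$-leaf according to $\Delta(U)$). Companion nodes: nodes with rule Un; companion leaves of $m$: leaves strictly below $m$ with the same formula and $S_n\subseteq S_m$, excluding companion leaves of companion nodes strictly below $m$. For a child $n'$ of $n$: $s'<_{n',n}s$ iff $s'\in S_{n'}$, $s\in S_n$ and: rule $[K]$, $s\xrightarrow{K}s'$; rule $(\langle K\rangle,f)$, $s'=f(s)$; rule $(\exists,f)$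 and ($n'$ first child, $s'\in\mathrm{succ}_<(s,f(s))$) or ($n'$ second child, $s'=\mathrm{succ}(s,f(s))$); rule $(\forall,g)$ and ($n'$ first child, $s'=\mathrm{succ}(s,g(s,\delta))$ for some $\delta\in\mathrm{delays}(s)$ with $g(s,\delta)<\delta$) or ($n'$ second child, same with $g(s,\delta)=\delta$); any other rule and $s'=s$. $\lessdot_{n',n}$ is least with $s\lessdot_{n,n}s$ and ($s'\lessdot_{n',m}s''$, $s''<_{m,n}s$)$\Rightarrow s'\lessdot_{n',n}s$. $<:_{n',n}$, $<:_m$ least with: $s'<:_m s$ iff some companion leaf $m'$ of $m$ has $s'\in S_{m'}$, $s'<:_{m',m}s$; $s'<:_{n',n}s$ iff $s'\in S_{n'}$, $s\in S_n$, and $s'\lessdot_{n',n}s$ or some companion node $m\notin\{n,n'\}$ and $t,t'\in S_m$ satisfy $s'<:_{n',m}t'$, $t'(<:_m)^+t$, $t\lessdot_{m,n}s$. A leaf is successful iff: formula $Z$ and $S_n\subseteq\mathcal V(Z)$; or $\neg Z$ and $S_n\cap\mathcal V(Z)=\emptyset$; or $\nu$-leaf; or $\mu$-leaf whose companion node $m$ has $<:_m$ well-founded. A timed tableau is successful iff all leaves are successful. *)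

(* Defs.v *)
From Stdlib Require Import Reals List Arith.
Import ListNotations.

Set Implicit Arguments.
Unset Strict Implicit.

(* Timed sort: Sigma = R_{>=0} (+) Act.  Delays are labelled [Dl d];   *)
(* negative [Dl d] are not elements of Sigma, and [is_TTS] forbids     *)
(* transitions carrying them.                                          *)
Inductive lab (Act : Type) : Type :=
| Dl (d : R)
| Ac (a : Act).
Arguments Dl {Act} d.
Arguments Ac {Act} a.

Section TTSdef.
Variables (St Act : Type) (tr : St -> lab Act -> St -> Prop).

Definition is_TTS : Prop :=
  (forall s d s', tr s (Dl d) s' -> (0 <= d)%R) /\
  (forall s, tr s (Dl 0%R) s) /\
  (forall s s' s'' d, (0 <= d)%R -> tr s (Dl d) s' -> tr s (Dl d) s'' -> s' = s'') /\
  (forall s s' s'' d d', (0 <= d)%R -> (0 <= d')%R ->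
      tr s (Dl d) s' -> tr s' (Dl d') s'' -> tr s (Dl (d + d')%R) s'') /\
  (forall s s' d d' d'', (0 <= d')%R -> (0 <= d'')%R -> d = (d' + d'')%R ->
      tr s (Dl d) s' -> exists s'', tr s (Dl d') s'' /\ tr s'' (Dl d'') s').
End TTSdef.

Inductive form (Act : Type) : Type :=
| FVar (z : nat)
| FNeg (f : form Act)
| FAnd (f g : form Act)
| FBox (K : lab Act -> Prop) (f : form Act)
| FAll (f g : form Act)
| FNu (z : nat) (f : form Act).
Arguments FVar {Act} z.

Section FormDefs.
Variable Act : Type.

Fixpoint substneg (z : nat) (f : form Act) : form Act :=
  match f with
  | FVar y => if Nat.eqb y z then FNeg (FVar y) else FVar y
  | FNeg g => FNeg (substneg z g)
  | FAnd g h => FAnd (substneg z g) (substneg z h)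
  | FBox K g => FBox K (substneg z g)
  | FAll g h => FAll (substneg z g) (substneg z h)
  | FNu y g => if Nat.eqb y z then FNu y g else FNu y (substneg z g)
  end.

Definition FOr (f g : form Act) := FNeg (FAnd (FNeg f) (FNeg g)).
Definition FDia K (f : form Act) := FNeg (FBox K (FNeg f)).
Definition FEx (f g : form Act) := FNeg (FAll (FNeg f) (FNeg g)).
Definition FMu z (f : form Act) := FNeg (FNu z (FNeg (substneg z f))).

(* every free occurrence of z in f lies under a number of negations of
   parity b (b = true : even) *)
Fixpoint polok (z : nat) (b : bool) (f : form Act) : Prop :=
  match f with
  | FVar y => y = z -> b = true
  | FNeg g => polok z (negb b) g
  | FAnd g h => polok z b g /\ polok z b h
  | FBox _ g => polok z b g
  | FAll g h => polok z b g /\ polok z b h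
  | FNu y g => if Nat.eqb y z then True else polok z b g
  end.

Fixpoint wf (f : form Act) : Prop :=
  match f with
  | FVar _ => True
  | FNeg g => wf g
  | FAnd g h => wf g /\ wf h
  | FBox _ g => wf g
  | FAll g h => wf g /\ wf h
  | FNu z g => polok z true g /\ wf g
  end.
End FormDefs.

Definition upd (St : Type) (V : nat -> St -> Prop) (z : nat) (X : St -> Prop)
  : nat -> St -> Prop := fun y => if Nat.eqb y z then X else V y.

Section Sem.
Variables (St Act : Type) (tr : St -> lab Act -> St -> Prop).

Fixpoint sem (V : nat -> St -> Prop) (f : form Act) : St -> Prop :=
  match f with
  | FVar z => V z
  | FNeg g => fun s => ~ sem V g s
  | FAnd g h => fun s => sem V g s /\ sem V h s
  | FBox K g => fun s => forall l s', K l -> tr s l s' -> sem V g s'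
  | FAll g h => fun s =>
      forall d s', tr s (Dl d) s' ->
        (forall d' s'', (d' < d)%R -> tr s (Dl d') s'' -> ~ sem V g s'') ->
        sem V h s'
  | FNu z g => fun s =>
      exists X : St -> Prop, X s /\ (forall u, X u -> sem (upd V z X) g u)
  end.
End Sem.

Inductive pform (Act : Type) : Type :=
| PVar (z : nat)
| PNVar (z : nat)
| PAnd (f g : pform Act)
| POr (f g : pform Act)
| PBox (K : lab Act -> Prop) (f : pform Act)
| PDia (K : lab Act -> Prop) (f : pform Act)
| PAll (f g : pform Act)
| PEx (f g : pform Act)
| PNu (z : nat) (f : pform Act)
| PMu (z : nat) (f : pform Act).
Arguments PVar {Act} z.
Arguments PNVar {Act} z.

Section PDefs.
Variable Act : Type.

Fixpoint embed (f : pform Act) : form Act :=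
  match f with
  | PVar z => FVar z
  | PNVar z => FNeg (FVar z)
  | PAnd a b => FAnd (embed a) (embed b)
  | POr a b => FOr (embed a) (embed b)
  | PBox K a => FBox K (embed a)
  | PDia K a => FDia K (embed a)
  | PAll a b => FAll (embed a) (embed b)
  | PEx a b => FEx (embed a) (embed b)
  | PNu z a => FNu z (embed a)
  | PMu z a => FMu z (embed a)
  end.

Fixpoint pfree (U : nat) (f : pform Act) : Prop :=
  match f with
  | PVar y | PNVar y => y = U
  | PAnd a b | POr a b | PAll a b | PEx a b => pfree U a \/ pfree U b
  | PBox _ a | PDia _ a => pfree U a
  | PNu y a | PMu y a => y <> U /\ pfree U a
  end.

Fixpoint pnegfree (U : nat) (f : pform Act) : Prop :=
  match f with
  | PVar _ => False
  | PNVar y => y = U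
  | PAnd a b | POr a b | PAll a b | PEx a b => pnegfree U a \/ pnegfree U b
  | PBox _ a | PDia _ a => pnegfree U a
  | PNu y a | PMu y a => y <> U /\ pnegfree U a
  end.

Fixpoint pbound (U : nat) (f : pform Act) : Prop :=
  match f with
  | PVar _ | PNVar _ => False
  | PAnd a b | POr a b | PAll a b | PEx a b => pbound U a \/ pbound U b
  | PBox _ a | PDia _ a => pbound U a
  | PNu y a | PMu y a => y = U \/ pbound U a
  end.

Definition poccurs (U : nat) (f : pform Act) : Prop := pfree U f \/ pbound U f.

Fixpoint psubst (z U : nat) (f : pform Act) : pform Act :=
  match f with
  | PVar y => if Nat.eqb y z then PVar U else PVar y
  | PNVar y => if Nat.eqb y z then PNVar U else PNVar y
  | PAnd a b => PAnd (psubst z U a) (psubst z U b)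
  | POr a b => POr (psubst z U a) (psubst z U b)
  | PBox K a => PBox K (psubst z U a)
  | PDia K a => PDia K (psubst z U a)
  | PAll a b => PAll (psubst z U a) (psubst z U b)
  | PEx a b => PEx (psubst z U a) (psubst z U b)
  | PNu y a => if Nat.eqb y z then PNu y a else PNu y (psubst z U a)
  | PMu y a => if Nat.eqb y z then PMu y a else PMu y (psubst z U a)
  end.

(* definition lists: (U_1 = Phi_1) ... (U_n = Phi_n), extended on the right *)
Definition deflist := list (nat * pform Act).

Definition dom (D : deflist) : list nat := map fst D.

Definition dlook (D : deflist) (U : nat) : option (pform Act) :=
  match find (fun p => Nat.eqb (fst p) U) D with
  | Some p => Some (snd p)
  | None => None
  end.

Definition dl_ok (D : deflist) : Prop :=
  NoDup (dom D) /\
  (forall U phi, In U (dom D) -> In phi (map snd D) -> ~ pbound U phi) /\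
  (forall i j Ui phii Uj phij, (i <= j)%nat ->
     nth_error D i = Some (Ui, phii) -> nth_error D j = Some (Uj, phij) ->
     ~ pfree Uj phii).

Definition fresh (U : nat) (D : deflist) (phi : pform Act) : Prop :=
  ~ In U (dom D) /\ ~ poccurs U phi /\ (forall psi, In psi (map snd D) -> ~ poccurs U psi).
End PDefs.

Record sequent (St Act : Type) := Seq {
  sS : St -> Prop;
  sD : list (nat * pform Act);
  sF : pform Act }.

Inductive rule (St : Type) : Type :=
| RAnd | ROr | RBox
| RDia (f : St -> St)
| RSig | RUn | RThin
| REx (f : St -> R)
| RAll (g : St -> R -> R).
Arguments RAnd {St}. Arguments ROr {St}. Arguments RBox {St}.
Arguments RSig {St}. Arguments RUn {St}. Arguments RThin {St}.

Inductive tab (St Act : Type) : Type :=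
| Leaf (q : sequent St Act)
| Inner (q : sequent St Act) (r : rule St) (ch : list (tab St Act)).

Definition seteq (St : Type) (A B : St -> Prop) := forall x, A x <-> B x.

Section Tableaux.
Variables (St Act : Type) (tr : St -> lab Act -> St -> Prop) (V : nat -> St -> Prop).

Definition seq_ok (q : sequent St Act) : Prop :=
  dl_ok (sD q) /\ wf (embed (sF q)) /\
  (forall U, In U (dom (sD q)) -> ~ pnegfree U (sF q) /\ ~ pbound U (sF q)).

Definition same (c : sequent St Act) (S : St -> Prop) (D : list (nat * pform Act))
  (phi : pform Act) : Prop := seteq (sS c) S /\ sD c = D /\ sF c = phi.

Definition rule_ok (q : sequent St Act) (r : rule St) (cs : list (sequent St Act)) : Prop :=
  let S := sS q in let D := sD q in
  match r with
  | RAnd => exists a b c1 c2, sF q = PAnd a b /\ cs = [c1; c2] /\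
      same c1 S D a /\ same c2 S D b
  | ROr => exists a b c1 c2, sF q = POr a b /\ cs = [c1; c2] /\
      sD c1 = D /\ sF c1 = a /\ sD c2 = D /\ sF c2 = b /\
      seteq S (fun s => sS c1 s \/ sS c2 s)
  | RBox => exists K a c, sF q = PBox K a /\ cs = [c] /\
      same c (fun s' => exists s l, S s /\ K l /\ tr s l s') D a
  | RDia f => exists K a c, sF q = PDia K a /\ cs = [c] /\
      (forall s, S s -> exists l, K l /\ tr s l (f s)) /\
      same c (fun s' => exists s, S s /\ s' = f s) D a
  | RSig => exists z a U c, (sF q = PNu z a \/ sF q = PMu z a) /\ cs = [c] /\
      fresh U D (sF q) /\ same c S (D ++ [(U, sF q)]) (PVar U)
  | RUn => exists U z a c, sF q = PVar U /\
      (dlook D U = Some (PNu z a) \/ dlook D U = Some (PMu z a)) /\ cs = [c] /\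
      same c S D (psubst z U a)
  | RThin => exists c, cs = [c] /\ sD c = D /\ sF c = sF q /\
      (forall s, S s -> sS c s)
  | REx f => exists a b c1 c2, sF q = PEx a b /\ cs = [c1; c2] /\
      (forall s, S s -> exists s', tr s (Dl (f s)) s') /\
      same c1 (fun t => exists s d, S s /\ (d < f s)%R /\ tr s (Dl d) t) D a /\
      same c2 (fun t => exists s, S s /\ tr s (Dl (f s)) t) D b
  | RAll g => exists a b c1 c2, sF q = PAll a b /\ cs = [c1; c2] /\
      (forall s d s', S s -> tr s (Dl d) s' -> (0 <= g s d)%R /\ (g s d <= d)%R) /\
      same c1 (fun t => exists s d s', S s /\ tr s (Dl d) s' /\
                 (g s d < d)%R /\ tr s (Dl (g s d)) t) D a /\
      same c2 (fun t => exists s d s', S s /\ tr s (Dl d) s' /\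
                 g s d = d /\ tr s (Dl (g s d)) t) D b
  end.

Fixpoint node_at (t : tab St Act) (p : list nat) : option (tab St Act) :=
  match p with
  | [] => Some t
  | i :: p' =>
      match t with
      | Leaf _ => None
      | Inner _ _ ch =>
          match nth_error ch i with
          | Some c => node_at c p'
          | None => None
          end
      end
  end.

Definition seq_of (c : tab St Act) : sequent St Act :=
  match c with Leaf q => q | Inner q _ _ => q end.

Definition strict_prefix (m n : list nat) : Prop := exists k, k <> [] /\ n = m ++ k.

Variable t : tab St Act.

Definition Sn (p : list nat) (s : St) : Prop :=
  exists c, node_at t p = Some c /\ sS (seq_of c) s.

Definition terminal (p : list nat) (q : sequent St Act) : Prop :=
  (exists z, (sF q = PVar z \/ sF q = PNVar z) /\ ~ In z (dom (sD q))) \/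
  (exists K a, sF q = PDia K a /\
     exists s, sS q s /\ ~ (exists l s', K l /\ tr s l s')) \/
  (exists U, sF q = PVar U /\ In U (dom (sD q)) /\
     exists m cm, strict_prefix m p /\ node_at t m = Some cm /\
       sF (seq_of cm) = PVar U /\ (forall s, sS q s -> sS (seq_of cm) s)).

Definition is_tableau (S : St -> Prop) (Phi : pform Act) : Prop :=
  seteq (sS (seq_of t)) S /\ sD (seq_of t) = [] /\ sF (seq_of t) = Phi /\
  (forall p c, node_at t p = Some c -> seq_ok (seq_of c)) /\
  (forall p q r ch, node_at t p = Some (Inner q r ch) -> rule_ok q r (map seq_of ch)) /\
  (forall p q, node_at t p = Some (Leaf q) -> terminal p q).

Definition lt1 (m : list nat) (s'' : St) (n : list nat) (s : St) : Prop :=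
  exists i q r ch c, m = n ++ [i] /\ node_at t n = Some (Inner q r ch) /\
    nth_error ch i = Some c /\ sS q s /\ sS (seq_of c) s'' /\
    match r with
    | RBox => exists K a, sF q = PBox K a /\ exists l, K l /\ tr s l s''
    | RDia f => s'' = f s
    | REx f => (i = 0%nat /\ exists d, (d < f s)%R /\ tr s (Dl d) s'') \/
               (i = 1%nat /\ tr s (Dl (f s)) s'')
    | RAll g => exists d s1, tr s (Dl d) s1 /\
               ((i = 0%nat /\ (g s d < d)%R) \/ (i = 1%nat /\ g s d = d)) /\
               tr s (Dl (g s d)) s''
    | _ => s'' = s
    end.

Inductive dle : list nat -> St -> list nat -> St -> Prop :=
| dle_refl n s : dle n s n s
| dle_step n' s' m s'' n s : dle n' s' m s'' -> lt1 m s'' n s -> dle n' s' n s.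

Definition comp_node (m : list nat) : Prop :=
  exists q ch, node_at t m = Some (Inner q RUn ch).

Definition cl_cond (m n : list nat) : Prop :=
  comp_node m /\ strict_prefix m n /\
  exists qn cm, node_at t n = Some (Leaf qn) /\ node_at t m = Some cm /\
    sF (seq_of cm) = sF qn /\ (forall s, sS qn s -> sS (seq_of cm) s).

Definition companion_leaf (m n : list nat) : Prop :=
  cl_cond m n /\ ~ (exists m', strict_prefix m m' /\ cl_cond m' n).

Inductive cyc : list nat -> St -> St -> Prop :=
| cyc_i m m' s' s : companion_leaf m m' -> Sn m' s' -> ord m' s' m s -> cyc m s' s
with ord : list nat -> St -> list nat -> St -> Prop :=
| ord_d n' s' n s : Sn n' s' -> Sn n s -> dle n' s' n s -> ord n' s' n s
| ord_c n' s' n s m t0 t1 : Sn n' s' -> Sn n s -> comp_node m -> m <> n -> m <> n' ->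
    Sn m t0 -> Sn m t1 -> ord n' s' m t1 -> cycp m t1 t0 -> dle m t0 n s ->
    ord n' s' n s
with cycp : list nat -> St -> St -> Prop :=
| cycp_1 m a b : cyc m a b -> cycp m a b
| cycp_s m a b c : cyc m a b -> cycp m b c -> cycp m a c.

Definition leaf_ok (p : list nat) (q : sequent St Act) : Prop :=
  (exists z, sF q = PVar z /\ ~ In z (dom (sD q)) /\ (forall s, sS q s -> V z s)) \/
  (exists z, sF q = PNVar z /\ ~ In z (dom (sD q)) /\ (forall s, sS q s -> ~ V z s)) \/
  (exists U z a, sF q = PVar U /\ dlook (sD q) U = Some (PNu z a)) \/
  (exists U z a, sF q = PVar U /\ dlook (sD q) U = Some (PMu z a) /\
     exists m, companion_leaf m p /\ well_founded (cyc m)).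

Definition successful : Prop :=
  forall p q, node_at t p = Some (Leaf q) -> leaf_ok p q.
End Tableaux.

(* Main.v *)
(* The tableau follows the syntax of the formula: every fixpoint subformula
   sigma Z.a gets one constant U, unfolded at a single companion node, and all
   further occurrences of U are leaves pointing to that node.  The only
   difficulty is to choose the witnesses of the rules so that the dependencies
   at mu-nodes are well-founded.  To this end each sequent is ranked by a
   well-ordered type W and environments e_w (w in W) interpreting the constants
   by approximants; its states are those satisfying the formula under some e_w,
   the least such w being the signature of the state, and witnesses are always
   chosen for the least w.  Entering mu Z.a replaces W by the lexicographic
   product of W with the approximants of the fixpoint.  Then dependencies never
   increase the signature, also when they pass through loops at inner companion
   nodes, and unfolding mu Z.a strictly decreases its component.
   Approximants are not indexed by ordinals: they are the members of the least
   family of sets closed under the operator and under unions, which inclusion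
   well-orders. *)
Require Import Defs.
From Stdlib Require Import Reals List Lra Lia Classical IndefiniteDescription.
From Stdlib Require Import FunctionalExtensionality PropExtensionality ProofIrrelevance.
Import ListNotations.

Set Implicit Arguments.
Unset Strict Implicit.

(** * Approximants without ordinals *)

Section Tower.
Variables (St : Type) (F : (St -> Prop) -> St -> Prop).

Definition incl_set (A B : St -> Prop) := forall x, A x -> B x.

Hypothesis F_mono : forall A B, incl_set A B -> incl_set (F A) (F B).

(** The bottom stage is the union over the empty family [Q]. *)
Inductive tower : (St -> Prop) -> Prop :=
| tower_step X : tower X -> tower (F X)
| tower_union (Q : (St -> Prop) -> Prop) :
    (forall X, Q X -> tower X) -> tower (fun x => exists X, Q X /\ X x).

Definition proper_incl (A B : St -> Prop) := incl_set A B /\ ~ incl_set B A.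

Lemma tower_prefixed P X : incl_set (F P) P -> tower X -> incl_set X P.
Proof.
  intros HP HX; induction HX as [X _ IH|Q _ IH]; intros x Hx.
  - exact (HP _ (F_mono IH Hx)).
  - destruct Hx as [X [HQ Hx]]; exact (IH _ HQ _ Hx).
Qed.

Lemma tower_inflationary X : tower X -> incl_set X (F X).
Proof.
  induction 1 as [X _ IH|Q _ IH]; intros x Hx.
  - exact (F_mono IH Hx).
  - destruct Hx as [X [HQ Hx]].
    assert (HX : incl_set X (fun x => exists X, Q X /\ X x)) by (intros y Hy; eauto).
    exact (F_mono HX (IH _ HQ _ Hx)).
Qed.

(** Zermelo's comparison argument. Having [F Y] rather than [Y] in the second case carries the
    induction through, and it leaves no room for a stage strictly between [Y] and [F Y]. *)
Lemma tower_dichotomy X Y : tower X -> tower Y -> incl_set X Y \/ incl_set (F Y) X.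
Proof.
  intros HX; revert Y; induction HX as [X HX IH|Q HQ IH]; intros Y HY.
  (* Inner induction on [Y]. The middle alternative is what a union delivers when no member contains
     [F X]; monotonicity turns it into the claim afterwards. *)
  - assert (H : incl_set (F X) Y \/ incl_set Y X \/ incl_set (F Y) X).
    { induction HY as [Y HY _|Q HQ IHQ].
      - destruct (IH Y HY) as [H|H]; [left; exact (F_mono H)|now right; left].
      - destruct (classic (exists Y, Q Y /\ incl_set (F X) Y)) as [[Y [HY H]]|H].
        + left; intros x Hx; exists Y; auto.
        + right; left; intros x [Y [HY Hx]].
          destruct (IHQ Y HY) as [H1|[H1|H1]].
          * destruct H; eauto.
          * auto.
          * exact (H1 _ (tower_inflationary (HQ _ HY) Hx)). }
    destruct H as [H|[H|H]].
    + now left.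
    + right; exact (F_mono H).
    + right; intros x Hx; exact (tower_inflationary HX (H _ Hx)).
  - destruct (classic (exists X, Q X /\ ~ incl_set X Y)) as [[X [H1 H2]]|H].
    + right; intros x Hx; exists X; split; trivial.
      destruct (IH X H1 Y HY) as [H|H]; [easy|exact (H _ Hx)].
    + left; intros x [X [H1 Hx]].
      destruct (classic (incl_set X Y)) as [H2|H2]; [exact (H2 _ Hx)|destruct H; eauto].
Qed.

Lemma tower_total X Y : tower X -> tower Y -> incl_set X Y \/ incl_set Y X.
Proof.
  intros HX HY; destruct (tower_dichotomy HX HY) as [H|H]; [now left|right].
  intros x Hx; exact (H _ (tower_inflationary HY Hx)).
Qed.

Lemma incl_set_antisym (A B : St -> Prop) : incl_set A B -> incl_set B A -> A = B.
Proof.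
  intros H1 H2; apply functional_extensionality; intro x.
  apply propositional_extensionality; split; auto.
Qed.

(** A stage strictly below [F X] lies within [X], and one strictly below a union lies strictly below
    some member, so accessibility passes up the construction. *)
Lemma tower_acc X : tower X -> Acc (fun A B => tower A /\ proper_incl A B) X.
Proof.
  induction 1 as [X HX IH|Q HQ IH]; constructor; intros Y [HY [H1 H2]].
  - destruct (tower_dichotomy HY HX) as [H|H]; [|easy].
    destruct (classic (incl_set X Y)) as [H3|H3].
    + now rewrite (incl_set_antisym H H3).
    + apply (Acc_inv IH); repeat split; trivial.
  - destruct (classic (exists X, Q X /\ ~ incl_set X Y)) as [[X [H3 H4]]|H].
    + destruct (tower_total HY (HQ _ H3)) as [H|H]; [|easy].
      apply (Acc_inv (IH _ H3)); repeat split; trivial.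
    + destruct H2; intros x [X [H3 Hx]].
      destruct (classic (incl_set X Y)) as [H4|H4]; [exact (H4 _ Hx)|destruct H; eauto].
Qed.

(* The witness is the largest stage that misses [x]. *)
Lemma tower_pred X x : tower X -> X x ->
  exists Y, tower Y /\ proper_incl Y X /\ F Y x.
Proof.
  intros HX Hx.
  pose (A := fun y => exists Y, (tower Y /\ ~ Y x) /\ Y y).
  assert (HA : tower A) by (apply tower_union; now intros Y []).
  assert (Hn : ~ A x) by (intros [Y [[_ H] H']]; easy).
  exists A; split; [trivial|split].
  - destruct (tower_total HA HX) as [H|H].
    + split; trivial; intro H'; exact (Hn (H' _ Hx)).
    + destruct (Hn (H _ Hx)).
  (* If [F A] missed [x], it would be one of the stages united in [A]; then [A] would be prefixed
     and would contain [X], hence [x]. *)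
  - apply NNPP; intro H; apply Hn.
    refine (tower_prefixed (P := A) _ HX Hx).
    intros y Hy; exists (F A); repeat split; trivial; now constructor.
Qed.

(** The union of all stages is itself a stage, and it is prefixed because applying [F] to it gives a
    stage again. *)
Lemma lfp_tower x : (forall P, incl_set (F P) P -> P x) -> exists X, tower X /\ X x.
Proof.
  intros H; pose (A := fun y => exists Y, tower Y /\ Y y).
  assert (HA : tower A) by (now apply tower_union).
  exists A; split; trivial; apply H; intros y Hy.
  exists (F A); split; trivial; now constructor.
Qed.
End Tower.

(** * Semantics and syntax of positive normal forms *)

Section Semantics.
Variables (St Act : Type) (tr : St -> lab Act -> St -> Prop).
Implicit Types (V : nat -> St -> Prop) (a b : pform Act).

(** Classical reading of the derived connectives, free of the negations that [embed] inserts; [PMu]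
    becomes the intersection of the prefixed sets. *)
Fixpoint psem V (f : pform Act) : St -> Prop :=
  match f with
  | PVar z => V z
  | PNVar z => fun s => ~ V z s
  | PAnd a b => fun s => psem V a s /\ psem V b s
  | POr a b => fun s => psem V a s \/ psem V b s
  | PBox K a => fun s => forall l s', K l -> tr s l s' -> psem V a s'
  | PDia K a => fun s => exists l s', K l /\ tr s l s' /\ psem V a s'
  | PAll a b => fun s => forall d s', tr s (Dl d) s' ->
      psem V b s' \/ exists d' s'', (d' < d)%R /\ tr s (Dl d') s'' /\ psem V a s''
  | PEx a b => fun s => exists d s', tr s (Dl d) s' /\ psem V b s' /\
      forall d' s'', (d' < d)%R -> tr s (Dl d') s'' -> psem V a s''
  | PNu z a => fun s => exists X : St -> Prop, X s /\ incl_set X (psem (upd V z X) a)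
  | PMu z a => fun s => forall X : St -> Prop, incl_set (psem (upd V z X) a) X -> X s
  end.

Lemma upd_eq V z X : upd V z X z = X.
Proof. unfold upd; now rewrite Nat.eqb_refl. Qed.

Lemma upd_neq V z X y : y <> z -> upd V z X y = V y.
Proof. intro H; unfold upd; now rewrite (proj2 (Nat.eqb_neq y z) H). Qed.

Lemma upd_same V z X Y : upd (upd V z X) z Y = upd V z Y.
Proof.
  apply functional_extensionality; intro y; unfold upd; now destruct (Nat.eqb y z).
Qed.

Lemma upd_comm V z X y Y : z <> y -> upd (upd V z X) y Y = upd (upd V y Y) z X.
Proof.
  intro H; apply functional_extensionality; intro x; unfold upd.
  destruct (Nat.eqb_spec x y), (Nat.eqb_spec x z); congruence.
Qed.

Lemma sem_substneg z (f : form Act) V X s :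
  sem tr (upd V z X) (substneg z f) s <-> sem tr (upd V z (fun u => ~ X u)) f s.
Proof.
  revert V s; induction f as [y|f IH|f IHf g IHg|K f IH|f IHf g IHg|y f IH]; intros V s; cbn.
  - destruct (Nat.eqb_spec y z) as [->|H]; cbn.
    + now rewrite !upd_eq.
    + now rewrite !upd_neq.
  - now rewrite IH.
  - now rewrite IHf, IHg.
  - split; intros H l s' Hl Hs; apply IH; eauto.
  - split; intros H d s' Hs Hd; apply IHg; apply (H d s' Hs); intros d' s'' H1 H2 H3;
      apply (Hd d' s'' H1 H2); now apply IHf.
  - destruct (Nat.eqb_spec y z) as [->|H]; cbn.
    + now setoid_rewrite upd_same.
    + split; intros [Y [H1 H2]]; exists Y; split; trivial; intros u Hu.
      * rewrite upd_comm by congruence; apply IH; rewrite upd_comm by congruence; auto.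
      * rewrite upd_comm by congruence; apply IH; rewrite upd_comm by congruence; auto.
Qed.

Lemma sem_embed V a s : sem tr V (embed a) s <-> psem V a s.
Proof.
  revert V s; induction a as [z|z|a IHa b IHb|a IHa b IHb|K a IHa|K a IHa|a IHa b IHb
    |a IHa b IHb|z a IHa|z a IHa]; intros V s; cbn.
  - easy.
  - easy.
  - now rewrite IHa, IHb.
  - rewrite IHa, IHb; tauto.
  - now setoid_rewrite IHa.
  - setoid_rewrite IHa; split.
    + intros H; apply NNPP; intro H'; apply H; intros l s' Hl Hs Ha; eauto 6.
    + intros [l [s' H]] H'; apply (H' l s'); tauto.
  - split; intros H d s' Hs.
    + apply NNPP; intro H'; apply H'; left; apply IHb, (H d s' Hs).
      intros d' s'' H1 H2 H3; apply H'; right; exists d', s''; rewrite <- IHa; auto.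
    + intros H1; apply IHb; destruct (H d s' Hs) as [H2|[d' [s'' [H2 [H3 H4]]]]]; trivial.
      destruct (H1 d' s'' H2 H3); now apply IHa.
  - split.
    + intros H; apply NNPP; intro H'; apply H; intros d s' Hs Hd Hb.
      apply H'; exists d, s'; rewrite <- IHb; repeat split; trivial.
      intros d' s'' H1 H2; apply IHa, NNPP; exact (Hd d' s'' H1 H2).
    + intros [d [s' [Hs [Hb Ha]]]] H; apply (H d s' Hs).
      * intros d' s'' H1 H2 H3; apply H3, IHa; eauto.
      * now apply IHb.
  - split; intros [X [H1 H2]]; exists X; split; trivial; intros u Hu; apply IHa, H2, Hu.
  - split.
    (* Duality: the complement of a prefixed set is postfixed for the dual operator. *)
    + intros H X HX; apply NNPP; intro Hs; apply H; exists (fun u => ~ X u); split; trivial.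
      intros u Hu H'; apply Hu, HX, IHa; rewrite sem_substneg in H'.
      replace X with (fun u => ~ ~ X u); trivial.
      apply incl_set_antisym; intros x Hx; [now apply NNPP|tauto].
    + intros H [X [Hs HX]]; refine (H (fun u => ~ X u) _ Hs); intros u Hu Hx.
      apply (HX u Hx); now apply sem_substneg, IHa.
Qed.

Lemma psem_agree a V V' s : (forall z, pfree z a -> V z = V' z) ->
  psem V a s <-> psem V' a s.
Proof.
  revert V V' s; induction a as [z|z|a IHa b IHb|a IHa b IHb|K a IHa|K a IHa|a IHa b IHb
    |a IHa b IHb|z a IHa|z a IHa]; intros V V' s H; cbn in *.
  - now rewrite (H z).
  - now rewrite (H z).
  - rewrite (IHa V V'), (IHb V V') by auto; tauto.
  - rewrite (IHa V V'), (IHb V V') by auto; tauto.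
  - setoid_rewrite (fun s => IHa V V' s H); tauto.
  - setoid_rewrite (fun s => IHa V V' s H); tauto.
  - setoid_rewrite (fun s => IHa V V' s (fun z h => H z (or_introl h))).
    setoid_rewrite (fun s => IHb V V' s (fun z h => H z (or_intror h))); tauto.
  - setoid_rewrite (fun s => IHa V V' s (fun z h => H z (or_introl h))).
    setoid_rewrite (fun s => IHb V V' s (fun z h => H z (or_intror h))); tauto.
  - assert (HX : forall X u, psem (upd V z X) a u <-> psem (upd V' z X) a u).
    { intros X u; apply IHa; intros y Hy; unfold upd.
      destruct (Nat.eqb_spec y z); auto. }
    split; intros [X [H1 H2]]; exists X; split; trivial; intros u Hu; apply HX; auto.
  - assert (HX : forall X u, psem (upd V z X) a u <-> psem (upd V' z X) a u).
    { intros X u; apply IHa; intros y Hy; unfold upd.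
      destruct (Nat.eqb_spec y z); auto. }
    split; intros H1 X H2; apply H1; intros u Hu; apply H2, HX, Hu.
Qed.

Lemma psem_mono a z V X Y : ~ pnegfree z a -> incl_set X Y ->
  incl_set (psem (upd V z X) a) (psem (upd V z Y) a).
Proof.
  intros Hn HXY; revert V Hn; induction a as [y|y|a IHa b IHb|a IHa b IHb|K a IHa|K a IHa
    |a IHa b IHb|a IHa b IHb|y a IHa|y a IHa]; intros V Hn s; cbn in *.
  - unfold upd; destruct (Nat.eqb_spec y z); auto.
  - rewrite !upd_neq by congruence; trivial.
  - intros [H1 H2]; split; [apply IHa|apply IHb]; tauto.
  - intros [H|H]; [left; apply IHa|right; apply IHb]; tauto.
  - intros H l s' Hl Hs; apply IHa; eauto.
  - intros (l & s' & H1 & H2 & H3); exists l, s'; repeat split; trivial; apply IHa; trivial.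
  - intros H d s' Hs; destruct (H d s' Hs) as [H1|(d' & s'' & H1 & H2 & H3)].
    + left; apply IHb; tauto.
    + right; exists d', s''; repeat split; trivial; apply IHa; tauto.
  - intros (d & s' & H1 & H2 & H3); exists d, s'; repeat split; trivial.
    + apply IHb; tauto.
    + intros d' s'' H4 H5; apply IHa; [tauto|eauto].
  - intros [P [H1 H2]]; exists P; split; trivial; intros u Hu.
    destruct (Nat.eq_dec y z) as [->|Hyz].
    + rewrite upd_same; generalize (H2 u Hu); now rewrite upd_same.
    + rewrite upd_comm by congruence; apply IHa; [tauto|].
      rewrite upd_comm by congruence; auto.
  - intros H P HP; apply H; intros u Hu; apply HP.
    destruct (Nat.eq_dec y z) as [->|Hyz].
    + rewrite upd_same in Hu |- *; trivial.
    + rewrite upd_comm by congruence; apply IHa; [tauto|].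
      rewrite upd_comm by congruence; trivial.
Qed.

Lemma psem_psubst a z U V s : ~ pbound U a ->
  psem V (psubst z U a) s <-> psem (upd V z (V U)) a s.
Proof.
  revert V s; induction a as [y|y|a IHa b IHb|a IHa b IHb|K a IHa|K a IHa|a IHa b IHb
    |a IHa b IHb|y a IHa|y a IHa]; intros V s H; cbn in *.
  - unfold upd; now destruct (Nat.eqb y z).
  - unfold upd; now destruct (Nat.eqb y z).
  - rewrite IHa, IHb; tauto.
  - rewrite IHa, IHb; tauto.
  - setoid_rewrite (fun V s => IHa V s H); tauto.
  - setoid_rewrite (fun V s => IHa V s H); tauto.
  - setoid_rewrite (fun V s => IHa V s (fun h => H (or_introl h))).
    setoid_rewrite (fun V s => IHb V s (fun h => H (or_intror h))); tauto.
  - setoid_rewrite (fun V s => IHa V s (fun h => H (or_introl h))).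
    setoid_rewrite (fun V s => IHb V s (fun h => H (or_intror h))); tauto.
  - destruct (Nat.eqb_spec y z) as [->|Hyz]; cbn.
    + now setoid_rewrite upd_same.
    + assert (HX : forall X u, psem (upd V y X) (psubst z U a) u <->
                               psem (upd (upd V z (V U)) y X) a u).
      { intros X u; rewrite IHa, upd_comm by tauto.
        rewrite (@upd_neq V y X U) by (intro; subst; tauto).
        now rewrite upd_comm by congruence. }
      split; intros [X [H1 H2]]; exists X; split; trivial; intros u Hu; apply HX; auto.
  - destruct (Nat.eqb_spec y z) as [->|Hyz]; cbn.
    + now setoid_rewrite upd_same.
    + assert (HX : forall X u, psem (upd V y X) (psubst z U a) u <->
                               psem (upd (upd V z (V U)) y X) a u).
      { intros X u; rewrite IHa, upd_comm by tauto.
        rewrite (@upd_neq V y X U) by (intro; subst; tauto).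
        now rewrite upd_comm by congruence. }
      split; intros H1 X H2; apply H1; intros u Hu; apply H2, HX, Hu.
Qed.
End Semantics.

(** * Positivity, substitution of constants and definition lists *)

Section Syntax.
Variable Act : Type.
Implicit Types (a b : pform Act) (f : form Act).

Lemma polok_substneg_neq z y c f : y <> z -> polok z c (substneg y f) <-> polok z c f.
Proof.
  intros H; revert c; induction f as [x|f IH|f IHf g IHg|K f IH|f IHf g IHg|x f IH];
    intros c; cbn.
  - destruct (Nat.eqb_spec x y) as [->|Hx]; cbn; [|tauto].
    split; intros; congruence.
  - apply IH.
  - now rewrite IHf, IHg.
  - apply IH.
  - now rewrite IHf, IHg.
  - destruct (Nat.eqb_spec x y) as [->|Hx]; cbn; [tauto|].
    destruct (Nat.eqb x z); [tauto|apply IH].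
Qed.

Lemma polok_substneg_eq z c f : polok z (negb c) (substneg z f) <-> polok z c f.
Proof.
  revert c; induction f as [x|f IH|f IHf g IHg|K f IH|f IHf g IHg|x f IH]; intros c; cbn.
  - destruct (Nat.eqb_spec x z) as [->|Hx]; cbn.
    + destruct c; cbn; tauto.
    + tauto.
  - apply IH.
  - now rewrite IHf, IHg.
  - apply IH.
  - now rewrite IHf, IHg.
  - destruct (Nat.eqb_spec x z) as [->|Hx]; cbn.
    + rewrite Nat.eqb_refl; tauto.
    + rewrite (proj2 (Nat.eqb_neq x z) Hx); apply IH.
Qed.

Lemma wf_substneg z f : wf (substneg z f) <-> wf f.
Proof.
  induction f as [x|f IH|f IHf g IHg|K f IH|f IHf g IHg|x f IH]; cbn; try tauto.
  - destruct (Nat.eqb x z); cbn; tauto.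
  - destruct (Nat.eqb_spec x z) as [->|Hx]; cbn; [tauto|].
    rewrite polok_substneg_neq by congruence; tauto.
Qed.

(** Each derived connective places an even number of negations above its arguments, so only [PNVar]
    affects the parity. *)
Lemma polok_embed z a : polok z true (embed a) <-> ~ pnegfree z a.
Proof.
  induction a as [y|y|a IHa b IHb|a IHa b IHb|K a IHa|K a IHa|a IHa b IHb
    |a IHa b IHb|y a IHa|y a IHa]; cbn; try tauto.
  - split; [intros H Hy; now specialize (H Hy)|tauto].
  - destruct (Nat.eqb_spec y z) as [->|Hy]; tauto.
  - destruct (Nat.eqb_spec y z) as [->|Hy]; [tauto|].
    rewrite polok_substneg_neq by trivial; tauto.
Qed.

Lemma wf_embed_nu z a : wf (embed (PNu z a)) <-> ~ pnegfree z a /\ wf (embed a).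
Proof. cbn; now rewrite polok_embed. Qed.

(** The negation directly below [FNu] and the one put on [z] by [substneg] cancel in the parity
    count. *)
Lemma wf_embed_mu z a : wf (embed (PMu z a)) <-> ~ pnegfree z a /\ wf (embed a).
Proof.
  cbn; rewrite <- polok_embed, wf_substneg.
  now rewrite (polok_substneg_eq z true).
Qed.

Lemma pnegfree_psubst x z U a : pnegfree x (psubst z U a) ->
  pnegfree x a \/ (x = U /\ pnegfree z a).
Proof.
  induction a as [y|y|a IHa b IHb|a IHa b IHb|K a IHa|K a IHa|a IHa b IHb
    |a IHa b IHb|y a IHa|y a IHa]; cbn; try tauto.
  - destruct (Nat.eqb y z); cbn; tauto.
  - destruct (Nat.eqb_spec y z); cbn; intuition.
  - destruct (Nat.eqb_spec y z); cbn; tauto.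
  - destruct (Nat.eqb_spec y z); cbn; tauto.
Qed.

Lemma pbound_psubst x z U a : pbound x (psubst z U a) <-> pbound x a.
Proof.
  induction a as [y|y|a IHa b IHb|a IHa b IHb|K a IHa|K a IHa|a IHa b IHb
    |a IHa b IHb|y a IHa|y a IHa]; cbn; try tauto;
  destruct (Nat.eqb y z); cbn; tauto.
Qed.

Lemma pnegfree_pfree x a : pnegfree x a -> pfree x a.
Proof. induction a; cbn; tauto. Qed.

Lemma wf_psubst z U a : ~ pbound U a -> wf (embed a) -> wf (embed (psubst z U a)).
Proof.
  induction a as [y|y|a IHa b IHb|a IHa b IHb|K a IHa|K a IHa|a IHa b IHb
    |a IHa b IHb|y a IHa|y a IHa]; try (cbn; tauto).
  - cbn; now destruct (Nat.eqb y z).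
  - cbn; now destruct (Nat.eqb y z).
  - cbn [psubst pbound]; destruct (Nat.eqb y z); trivial; rewrite !wf_embed_nu.
    intros H [H1 H2]; split; [|tauto].
    intro H3; apply pnegfree_psubst in H3; intuition.
  - cbn [psubst pbound]; destruct (Nat.eqb y z); trivial; rewrite !wf_embed_mu.
    intros H [H1 H2]; split; [|tauto].
    intro H3; apply pnegfree_psubst in H3; intuition.
Qed.

(** Measure of the main induction: unfolding a fixpoint leads to [psubst z U a], which is not a
    subformula of it but has the size of [a]. *)
Fixpoint psize a : nat :=
  match a with
  | PVar _ | PNVar _ => 0
  | PAnd a b | POr a b | PAll a b | PEx a b => S (psize a + psize b)
  | PBox _ a | PDia _ a | PNu _ a | PMu _ a => S (psize a)
  end.

Lemma psize_psubst z U a : psize (psubst z U a) = psize a.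
Proof.
  induction a as [y|y|a IHa b IHb|a IHa b IHb|K a IHa|K a IHa|a IHa b IHb
    |a IHa b IHb|y a IHa|y a IHa]; cbn; try congruence;
  destruct (Nat.eqb y z); cbn; congruence.
Qed.

Lemma poccurs_bounded a : exists N, forall U, (N <= U)%nat -> ~ poccurs U a.
Proof.
  unfold poccurs; induction a as [y|y|a [N HN] b [M HM]|a [N HN] b [M HM]|K a [N HN]
    |K a [N HN]|a [N HN] b [M HM]|a [N HN] b [M HM]|y a [N HN]|y a [N HN]]; cbn.
  1,2: exists (S y); lia.
  1,2,5,6: exists (N + M); intros U HU; specialize (HN U); specialize (HM U);
    assert (N <= U /\ M <= U) by lia; tauto.
  1,2: exists N; exact HN.
  all: exists (N + S y); intros U HU; specialize (HN U);
    assert (N <= U /\ y <> U) by lia; tauto.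
Qed.

Lemma fresh_exists (D : deflist Act) a : exists U, fresh U D a.
Proof.
  assert (HD : exists N, forall U, (N <= U)%nat ->
     ~ In U (dom D) /\ forall psi, In psi (map snd D) -> ~ poccurs U psi).
  { induction D as [|[x b] D [N HN]].
    - exists 0; cbn; tauto.
    - destruct (poccurs_bounded b) as [M HM]; exists (N + M + S x); intros U HU; cbn.
      destruct (HN U ltac:(lia)) as [H1 H2]; split.
      + intros [H|H]; [lia|tauto].
      + intros psi [<-|H]; [apply HM; lia|auto]. }
  destruct HD as [N HN], (poccurs_bounded a) as [M HM]; exists (N + M).
  destruct (HN (N + M) ltac:(lia)) as [H1 H2]; split; [trivial|split; trivial].
  apply HM; lia.
Qed.

Lemma dl_ok_snoc (D : deflist Act) U a : dl_ok D -> fresh U D a ->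
  (forall U', In U' (dom D) -> ~ pbound U' a) -> dl_ok (D ++ [(U, a)]).
Proof.
  unfold dl_ok, fresh, poccurs, dom; intros (H1 & H2 & H3) (F1 & F2 & F3) Hb.
  rewrite !map_app; cbn; repeat split.
  - apply NoDup_app; trivial.
    + constructor; [tauto|constructor].
    + intros x Hx [<-|[]]; tauto.
  - intros U' phi HU Hphi; apply in_app_iff in HU, Hphi; cbn in HU, Hphi.
    destruct HU as [HU|[<-|[]]], Hphi as [Hphi|[<-|[]]]; auto.
    intro H; apply (F3 phi Hphi); tauto.
  - intros i j Ui phii Uj phij Hij Hi Hj.
    destruct (Nat.lt_ge_cases j (length D)) as [Hl|Hl].
    + rewrite nth_error_app1 in Hi, Hj by lia; eauto.
    + rewrite nth_error_app2 in Hj by lia.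
      (* Only the last position remains for [j], so [Uj] is the fresh [U], which occurs in no
         right-hand side. *)
      destruct (j - length D) as [|n]; [|now destruct n]; cbn in Hj.
      injection Hj as <- <-.
      destruct (Nat.lt_ge_cases i (length D)) as [Hl'|Hl'].
      * rewrite nth_error_app1 in Hi by lia.
        intro H; apply (F3 phii); [|tauto].
        apply nth_error_In in Hi; apply in_map_iff; now exists (Ui, phii).
      * rewrite nth_error_app2 in Hi by lia.
        destruct (i - length D) as [|n]; [|now destruct n]; cbn in Hi.
        injection Hi as <- <-; tauto.
Qed.

Lemma dlook_snoc_old (D : deflist Act) U a x : In x (dom D) ->
  dlook (D ++ [(U, a)]) x = dlook D x.
Proof.
  unfold dlook, dom; induction D as [|[y b] D IH]; cbn; [tauto|].
  destruct (Nat.eqb_spec y x) as [->|H]; [trivial|]; intros [H'|H']; [easy|auto].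
Qed.

Lemma dlook_snoc_new (D : deflist Act) U a : ~ In U (dom D) ->
  dlook (D ++ [(U, a)]) U = Some a.
Proof.
  unfold dlook, dom; induction D as [|[y b] D IH]; cbn.
  - now rewrite Nat.eqb_refl.
  - destruct (Nat.eqb_spec y U) as [->|H]; tauto.
Qed.
End Syntax.

(** * Dependencies along paths *)

Section Paths.
Variables (St Act : Type) (tr : St -> lab Act -> St -> Prop).
Implicit Types (t T : tab St Act) (m n p k : list nat) (s : St).

Lemma node_at_app t p k T : node_at t p = Some T -> node_at t (p ++ k) = node_at T k.
Proof.
  revert t; induction p as [|i p IH]; intros t; cbn.
  - now intros [= ->].
  - destruct t as [q|q r ch]; [easy|].
    destruct (nth_error ch i); [apply IH|easy].
Qed.

Lemma node_at_child t p q r ch i c : node_at t p = Some (Inner q r ch) ->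
  nth_error ch i = Some c -> node_at t (p ++ [i]) = Some c.
Proof. intros Hp Hc; rewrite (node_at_app [i] Hp); cbn; now rewrite Hc. Qed.

Lemma app_neq_self p k : k <> [] -> p ++ k <> p.
Proof.
  intros Hk H; apply Hk; apply (app_inv_head p); now rewrite app_nil_r.
Qed.

Lemma dle_descends t n' s' n s : dle tr t n' s' n s -> exists k, n' = n ++ k.
Proof.
  induction 1 as [n s|n' s' m s'' n s _ [k ->] (i & q & r & ch & c & -> & _)].
  - exists []; now rewrite app_nil_r.
  - exists (i :: k); now rewrite <- app_assoc.
Qed.

(** Every step of [dle] lengthens the position, so only reflexivity can return to [n]. *)
Lemma dle_self t n s' s : dle tr t n s' n s -> s' = s.
Proof.
  intros H; inversion H as [|n' s1 m s'' n1 s1' H1 H2]; subst; trivial.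
  destruct (dle_descends H1) as [k Hk].
  destruct H2 as (i & q & r & ch & c & -> & _).
  rewrite <- app_assoc in Hk; symmetry in Hk; now apply app_neq_self in Hk.
Qed.

Lemma ord_Sn t n' s' n s : ord tr t n' s' n s -> Sn t n' s' /\ Sn t n s.
Proof. now intros []. Qed.

(* [ord], additionally allowing a loop at the upper node when that node is a
   companion node: the shape of what remains of a dependency of a node on [n']
   after one step down. *)
Definition ord2 t n' s' n s : Prop :=
  ord tr t n' s' n s \/
  exists u, comp_node t n /\ n <> n' /\ cycp tr t n u s /\ ord tr t n' s' n u.

Lemma lt1_Sn t m s'' n s : lt1 tr t m s'' n s -> Sn t m s'' /\ Sn t n s.
Proof.
  intros (i & q & r & ch & c & -> & Hn & Hc & Hs & Hs'' & _); split.
  - exists c; split; trivial; exact (node_at_child Hn Hc).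
  - now exists (Inner q r ch).
Qed.

(** [dle] grows at its upper end, so its topmost edge can be split off; this lets invariants of
    children be lifted to their parent. *)
Lemma ord_step t n' s' n s : ord tr t n' s' n s -> n' <> n ->
  exists i s'', lt1 tr t (n ++ [i]) s'' n s /\ ord2 t n' s' (n ++ [i]) s''.
Proof.
  intros H Hn; destruct H as [n' s' n s H1 H2 H|n' s' n s m t0 t1 H1 H2 Hm Hmn Hmn' H3 H4 H5 H6 H].
  - inversion H as [|n1 s1 m s'' n2 s2 Hd Hl]; subst; [easy|].
    assert (Hl' := Hl); destruct Hl' as (i & q & r & ch & c & -> & _).
    exists i, s''; split; trivial; left; constructor; trivial; apply (lt1_Sn Hl).
  - inversion H as [|n1 s1 m1 s'' n2 s2 Hd Hl]; subst; [easy|].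
    assert (Hl' := Hl); destruct Hl' as (i & q & r & ch & c & -> & _).
    exists i, s''; split; trivial.
    (* If the loop sits at the child itself, [ord_c] no longer applies with the child as upper node;
       the second case of [ord2] records the loop. *)
    destruct (list_eq_dec Nat.eq_dec m (n ++ [i])) as [->|Hne].
    + rewrite <- (dle_self Hd); right; now exists t1.
    + left; exact (ord_c H1 (proj1 (lt1_Sn Hl)) Hm Hne Hmn' H3 H4 H5 H6 Hd).
Qed.

Lemma strict_prefix_child m p i :
  strict_prefix m (p ++ [i]) <-> m = p \/ strict_prefix m p.
Proof.
  split.
  - intros [k [Hk H]]; destruct (exists_last Hk) as [k' [j ->]].
    rewrite app_assoc in H; apply app_inj_tail in H; destruct H as [-> ->].
    destruct k' as [|x k']; [left; now rewrite app_nil_r|right; now exists (x :: k')].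
  - intros [->|[k [Hk ->]]].
    + now exists [i].
    + exists (k ++ [i]); split; [now destruct k|now rewrite app_assoc].
Qed.
End Paths.

(** * Tableaux respecting ranks *)

Section Construction.
Variables (St Act : Type) (tr : St -> lab Act -> St -> Prop) (V : nat -> St -> Prop).
Hypothesis HT : is_TTS tr.

(** The requirements on a tableau that concern a node and its children only; those on leaves mention
    ancestors and so depend on the enclosing tree. *)
Definition ok_node (c : tab St Act) : Prop :=
  seq_ok (seq_of c) /\
  match c with Leaf _ => True | Inner q r ch => rule_ok tr q r (map (@seq_of St Act) ch) end.

Definition ok_tree (T : tab St Act) : Prop :=
  forall k c, node_at T k = Some c -> ok_node c.

Lemma ok_tree_inner q r ch : ok_node (Inner q r ch) -> Forall ok_tree ch ->
  ok_tree (Inner q r ch).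
Proof.
  intros H Hch [|i k] c; cbn.
  - now intros [= <-].
  - destruct (nth_error ch i) as [T|] eqn:E; [|easy].
    rewrite Forall_forall in Hch; apply (Hch T (nth_error_In _ _ E)).
Qed.

Definition comp_at (t : tab St Act) (m : list nat) (q : sequent St Act) : Prop :=
  exists ch, node_at t m = Some (Inner q RUn ch).

Section Ranked.
(* [W] plays the role of the signatures: [e w] interprets the definition
   constants by approximants.  Below, [G w s] is meant to say that [s] satisfies
   the formula of the node under [e w]. *)
Variables (W : Type) (lt : W -> W -> Prop) (e : W -> nat -> St -> Prop).

Definition rle (v w : W) := lt v w \/ v = w.

(** What a subtree assumes about the companion nodes above it. The inclusion of [e w U] makes the
    leaves labelled [U] terminal, uniqueness prevents a second node from claiming them, and the last
    clause keeps fresh constants new. *)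
Definition context (t : tab St Act) (p : list nat) (D : deflist Act) : Prop :=
  (forall U, In U (dom D) -> exists m q, strict_prefix m p /\ comp_at t m q /\
      sF q = PVar U /\ forall w s, e w U s -> sS q s) /\
  (forall U m m' q q', strict_prefix m p -> strict_prefix m' p -> comp_at t m q ->
      comp_at t m' q' -> sF q = PVar U -> sF q' = PVar U -> m = m') /\
  (forall m q, strict_prefix m p -> comp_at t m q ->
      exists U, In U (dom D) /\ sF q = PVar U).

(* In the second case the companion node lies above the subtree rooted at [p], so
   well-foundedness cannot be judged there yet. *)
Definition leaf_good (t : tab St Act) (p : list nat) (D : deflist Act)
  (n : list nat) (q : sequent St Act) : Prop :=
  terminal tr t n q /\
  (leaf_ok tr V t n q \/
   exists U, sF q = PVar U /\ In U (dom D) /\ dlook (sD q) U = dlook D U /\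
     forall m q', strict_prefix m p -> comp_at t m q' -> sF q' = PVar U ->
       companion_leaf t m n).

(** The invariant behind well-foundedness. It uses [ord2] because a dependency arriving from the
    parent of [p] may first loop at [p]. *)
Definition rank_good (t : tab St Act) (p : list nat) (D : deflist Act)
  (G : W -> St -> Prop) : Prop :=
  forall n q U s s' w, node_at t n = Some (Leaf q) -> sF q = PVar U -> In U (dom D) ->
    ord2 tr t n s' p s -> G w s -> exists w', rle w' w /\ e w' U s'.

(** The subtree is chosen before the tree [t] around it: companion leaves and dependencies are read
    in the whole tree, so it must work wherever it is placed. [D] lists the constants whose
    companion nodes lie above it. *)
Definition solves (D : deflist Act) (G : W -> St -> Prop) (q : sequent St Act) : Prop :=
  exists T, seq_of T = q /\ ok_tree T /\
    forall t p, node_at t p = Some T -> context t p D ->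
      (forall k q', node_at T k = Some (Leaf q') -> leaf_good t p D (p ++ k) q') /\
      rank_good t p D G.
End Ranked.

(** The rule-dependent clause of [lt1], detached from positions in a tree. *)
Definition edge (q : sequent St Act) (r : rule St) (i : nat) (s'' s : St) : Prop :=
  match r with
  | RBox => exists K a, sF q = PBox K a /\ exists l, K l /\ tr s l s''
  | RDia f => s'' = f s
  | REx f => (i = 0%nat /\ exists d, (d < f s)%R /\ tr s (Dl d) s'') \/
             (i = 1%nat /\ tr s (Dl (f s)) s'')
  | RAll g => exists d s1, tr s (Dl d) s1 /\
             ((i = 0%nat /\ (g s d < d)%R) \/ (i = 1%nat /\ g s d = d)) /\
             tr s (Dl (g s d)) s''
  | _ => s'' = s
  end.

Lemma Forall_exists_Forall2 (A B : Type) (R : A -> B -> Prop) l :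
  Forall (fun a => exists b, R a b) l -> exists l', Forall2 R l l'.
Proof.
  induction 1 as [|a l [b Hb] _ [l' Hl]]; [now exists []|exists (b :: l'); now constructor].
Qed.

Lemma Forall2_nth_error (A B : Type) (R : A -> B -> Prop) l l' : Forall2 R l l' ->
  forall i b, nth_error l' i = Some b -> exists a, nth_error l i = Some a /\ R a b.
Proof.
  induction 1 as [|a b l l' H _ IH]; intros [|i]; cbn; try easy; eauto.
  intros c [= <-]; eauto.
Qed.

(** * Comparison of ranks; inner nodes without unfolding, and leaves *)

Section Rules.
Variables (W : Type) (lt : W -> W -> Prop) (e : W -> nat -> St -> Prop).
Hypothesis lt_wf : well_founded lt.
Hypothesis lt_total : forall v w, rle lt v w \/ lt w v.

Lemma lt_irrefl w : ~ lt w w.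
Proof. induction (lt_wf w) as [w _ IH]; intro H; exact (IH w H H). Qed.

Lemma lt_asym v w : lt v w -> ~ lt w v.
Proof.
  revert w; induction (lt_wf v) as [v _ IH]; intros w H1 H2; exact (IH w H2 v H2 H1).
Qed.

Lemma lt_acyclic3 u v w : lt u v -> lt v w -> ~ lt w u.
Proof.
  revert v w; induction (lt_wf u) as [u _ IH]; intros v w H1 H2 H3.
  exact (IH w H3 u v H3 H1 H2).
Qed.

(** If transitivity failed, totality would close a cycle of length at most three, against
    well-foundedness. *)
Lemma rle_trans u v w : rle lt u v -> rle lt v w -> rle lt u w.
Proof.
  intros H1 H2; destruct (lt_total u w) as [H|H]; trivial; exfalso.
  destruct H1 as [H1| ->], H2 as [H2| ->].
  - exact (lt_acyclic3 H1 H2 H).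
  - exact (lt_asym H1 H).
  - exact (lt_asym H2 H).
  - exact (lt_irrefl H).
Qed.

Lemma rle_lt_trans u v w : rle lt u v -> lt v w -> lt u w.
Proof.
  intros [H1| ->] H2; trivial.
  destruct (lt_total w u) as [[H| ->]|H]; trivial; exfalso.
  - exact (lt_acyclic3 H1 H2 H).
  - exact (lt_asym H1 H2).
Qed.

Lemma least_rank (P : W -> Prop) : (exists w, P w) -> exists w, P w /\ forall v, P v -> rle lt w v.
Proof.
  intros [w Hw]; apply NNPP; intro H; revert Hw.
  induction (lt_wf w) as [w _ IH]; intro Hw; apply H; exists w; split; trivial.
  intros v Hv; destruct (lt_total w v) as [H1|H1]; trivial; destruct (IH v H1 Hv).
Qed.

(** Only [RUn] creates a companion node, so the child sees the same ones as its parent. *)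
Lemma context_child t p q r ch i D : node_at t p = Some (Inner q r ch) -> r <> RUn ->
  context e t p D -> context e t (p ++ [i]) D.
Proof.
  intros Hp Hr (H1 & H2 & H3).
  assert (Hs : forall m q', strict_prefix m (p ++ [i]) -> comp_at t m q' -> strict_prefix m p).
  { intros m q' Hm [ch' Hc]; apply strict_prefix_child in Hm; destruct Hm as [->|Hm]; trivial.
    rewrite Hp in Hc; now injection Hc. }
  split; [|split].
  - intros U HU; destruct (H1 U HU) as (m & q' & Hm & H); exists m, q'; split; trivial.
    apply strict_prefix_child; now right.
  - intros U m m' q1 q2 Hm Hm' Hc Hc'; apply (H2 U m m' q1 q2); eauto.
  - intros m q' Hm Hc; apply (H3 m q'); eauto.
Qed.

(** A dependency of the root starts with an edge, across which the last premise keeps the rank from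
    growing; the remainder is covered by the invariant of the child. *)
Lemma solves_inner D (G : W -> St -> Prop) q r (cs : list (sequent St Act * (W -> St -> Prop))) :
  seq_ok q -> r <> RUn -> rule_ok tr q r (map fst cs) ->
  Forall (fun c => solves lt e D (snd c) (fst c)) cs ->
  (forall i c s s'' w, nth_error cs i = Some c -> sS q s -> sS (fst c) s'' ->
     edge q r i s'' s -> G w s -> exists w', rle lt w' w /\ snd c w' s'') ->
  solves lt e D G q.
Proof.
  intros Hq Hr Hrule Hcs Hdec.
  assert (Hch : exists ch, Forall2 (fun c T => seq_of T = fst c /\ ok_tree T /\
    forall t p, node_at t p = Some T -> context e t p D ->
      (forall k q', node_at T k = Some (Leaf q') -> leaf_good t p D (p ++ k) q') /\
      rank_good lt e t p D (snd c)) cs ch).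
  { apply Forall_exists_Forall2; revert Hcs; apply Forall_impl.
    intros c [T HT']; now exists T. }
  destruct Hch as [ch Hch]; exists (Inner q r ch).
  assert (Hseqs : map (@seq_of St Act) ch = map fst cs).
  { clear - Hch; induction Hch as [|c T cs ch H _ IH]; cbn; trivial.
    rewrite IH; f_equal; apply H. }
  split; [trivial|split].
  - apply ok_tree_inner.
    + split; trivial; now rewrite Hseqs.
    + clear - Hch; induction Hch; constructor; tauto.
  - intros t p Hp Hctx; split.
    + intros [|i k] q'; cbn; [easy|].
      destruct (nth_error ch i) as [T|] eqn:E; [|easy]; intros Hk.
      destruct (Forall2_nth_error Hch E) as (c & Hc & HTq & HTok & HTt).
      destruct (HTt t (p ++ [i]) (node_at_child Hp E)) as [HL _].
      { exact (context_child i Hp Hr Hctx). }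
      specialize (HL k q' Hk); rewrite <- app_assoc in HL; cbn in HL.
      destruct HL as [HL1 HL2]; split; trivial.
      destruct HL2 as [HL2|(U & H1 & H2 & H3 & H4)]; [now left|right].
      exists U; do 3 (split; [trivial|]); intros m q1 Hm; apply H4.
      apply strict_prefix_child; now right.
    + intros n q' U s s' w Hn HqU HU Hord HG.
      (* No loop can occur at [p], which is not a companion node. *)
      assert (Ho : ord tr t n s' p s).
      { destruct Hord as [H|(t1 & [q1 [ch1 Hc]] & _)]; trivial.
        rewrite Hp in Hc; now injection Hc. }
      assert (Hnp : n <> p) by (intros ->; rewrite Hp in Hn; easy).
      destruct (ord_step Ho Hnp) as (i & s'' & Hlt & Ho2).
      destruct Hlt as (i' & q1 & r1 & ch1 & T & Hi & Hp' & HTi & Hs & Hs'' & He).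
      apply app_inj_tail in Hi; destruct Hi as [_ <-].
      rewrite Hp in Hp'; injection Hp' as <- <- <-.
      destruct (Forall2_nth_error Hch HTi) as (c & Hc & HTq & HTok & HTt).
      destruct (HTt t (p ++ [i]) (node_at_child Hp HTi)) as [_ HR].
      { exact (context_child i Hp Hr Hctx). }
      rewrite HTq in Hs''.
      destruct (Hdec i c s s'' w Hc Hs Hs'' He HG) as (w1 & Hw1 & HG1).
      destruct (HR n q' U s'' s' w1 Hn HqU HU Ho2 HG1) as (w2 & Hw2 & He2).
      exists w2; split; trivial; exact (rle_trans Hw2 Hw1).
Qed.

Lemma solves_leaf q :
  seq_ok q -> (forall z, ~ In z (dom (sD q)) -> forall w, e w z = V z) ->
  (forall s, sS q s -> exists w, psem tr (e w) (sF q) s) ->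
  (exists z, sF q = PVar z \/ sF q = PNVar z) ->
  solves lt e (sD q) (fun w => psem tr (e w) (sF q)) q.
Proof.
  intros Hq He Hsem [z Hz]; exists (Leaf q); split; [trivial|split].
  - intros [|i k] c; cbn; [|easy]; intros [= <-]; now split.
  - intros t p Hp Hctx; split.
    + intros [|i k] q'; cbn; [|easy]; intros [= <-]; rewrite app_nil_r.
      destruct (classic (In z (dom (sD q)))) as [Hin|Hin].
      * destruct Hz as [Hz|Hz].
        2: { destruct Hq as (_ & _ & H); destruct (H z Hin) as [H1 _]; rewrite Hz in H1.
             now destruct H1. }
        destruct Hctx as (H1 & H2 & H3).
        destruct (H1 z Hin) as (m & qm & Hm & [chm Hcm] & HFm & HSm).
        assert (Hincl : forall s, sS q s -> sS qm s).
        { intros s Hs; destruct (Hsem s Hs) as [w Hw]; rewrite Hz in Hw; eauto. }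
        split.
        -- right; right; exists z; repeat split; trivial.
           exists m, (Inner qm RUn chm); now repeat split.
        -- right; exists z; do 3 (split; [trivial|]).
           intros m' q' Hm' Hc' HF'.
           assert (m' = m) as ->.
           { apply (H2 z m' m q' qm); trivial; now exists chm. }
           split.
           ++ split; [now exists qm, chm|split; trivial].
              exists q, (Inner qm RUn chm); repeat split; trivial; cbn; congruence.
           (* A lower companion node with this formula would, by uniqueness in the context, be [m]
              itself. *)
           ++ intros (m2 & Hm2 & [q2 [ch2 Hq2]] & Hm2p & q3 & c3 & E1 & E2 & E3 & _).
              assert (m2 = m).
              { rewrite Hp in E1; injection E1 as <-.
                rewrite Hq2 in E2; injection E2 as <-; cbn in E3.
                apply (H2 z m2 m q2 qm); trivial; [now exists ch2|now exists chm|congruence]. }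
              subst; destruct Hm2 as [k [Hk Hkk]]; symmetry in Hkk; now apply app_neq_self in Hkk.
      * split; [left; now exists z|left].
        destruct Hz as [Hz|Hz]; [left|right; left]; exists z; repeat split; trivial;
          intros s Hs; destruct (Hsem s Hs) as [w Hw]; rewrite Hz in Hw; cbn in Hw;
          rewrite He in Hw; trivial.
    + intros n q' U s s' w Hn HqU HU Hord HG.
      assert (Ho : ord tr t n s' p s).
      { destruct Hord as [H|(t1 & [q1 [ch1 Hc]] & _)]; trivial.
        rewrite Hp in Hc; now injection Hc. }
      destruct (list_eq_dec Nat.eq_dec n p) as [->|Hnp].
      * rewrite Hp in Hn; injection Hn as <-; rewrite HqU in HG; cbn in HG.
        (* Either the path is trivial, or it would run through a loop strictly below a leaf. *)
        inversion Ho as [? ? ? ? _ _ Hd|? ? ? ? m0 t0 t1 _ _ _ Hm1 Hm2 _ _ Hom _ Hd]; subst.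
        -- rewrite (dle_self Hd); exists w; split; [now right|trivial].
        -- inversion Hd as [|n1 s1 m1 s'' n2 s2 Hd' Hl]; subst; [easy|].
           destruct Hl as (i & q1 & r & ch & c & -> & Hn & _).
           rewrite Hp in Hn; easy.
      * destruct (ord_step Ho Hnp) as (i & s'' & (i' & q1 & r & ch & c & _ & Hn' & _) & _).
        rewrite Hp in Hn'; easy.
Qed.
End Rules.

(** * Unfolding a fixpoint at its companion node *)

Section Unfolding.
Variables (W W' : Type) (lt : W -> W -> Prop) (lt' : W' -> W' -> Prop)
  (e : W -> nat -> St -> Prop) (pi : W' -> W) (X : W' -> St -> Prop)
  (D : deflist Act) (U z : nat) (a phi : pform Act).
Hypothesis lt_wf : well_founded lt.
Hypothesis lt_total : forall v w, rle lt v w \/ lt w v.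
Hypothesis lt_wf' : well_founded lt'.
Hypothesis lt_total' : forall v w, rle lt' v w \/ lt' w v.
Hypothesis pi_mono : forall v w, rle lt' v w -> rle lt (pi v) (pi w).
Hypothesis phi_fix : phi = PNu z a \/ phi = PMu z a.
Hypothesis U_fresh : fresh U D phi.

(** [W'] refines [W] through [pi]: the older constants keep their approximants, while [U] stands for
    the approximant [X w]. *)
Let e' w := upd (e (pi w)) U (X w).
Let D' := D ++ [(U, phi)].
(** The states of the companion node. All approximants are collected, so that every leaf labelled
    [U] is included in it. *)
Let Sm s := exists w, X w s.

Hypothesis phi_ok : forall S : St -> Prop, seq_ok (Seq S D phi).
Hypothesis U_ok : forall S : St -> Prop, seq_ok (Seq S D' (PVar U)).
Hypothesis X_unfold : forall w s, X w s -> exists v, rle lt' v w /\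
  (phi = PMu z a -> lt' v w) /\ psem tr (e' v) (psubst z U a) s.
Hypothesis body : solves lt' e' D' (fun w => psem tr (e' w) (psubst z U a))
  (Seq Sm D' (psubst z U a)).

Lemma in_dom_snoc y : In y (dom D') <-> In y (dom D) \/ y = U.
Proof.
  unfold D', dom; rewrite map_app, in_app_iff; cbn; intuition.
Qed.

Lemma env_old w y : In y (dom D) -> e' w y = e (pi w) y.
Proof. intros Hy; apply upd_neq; intros ->; now apply (proj1 U_fresh). Qed.

(** The companion nodes above [p] belong to constants of [D], and [U] is fresh, so [p] is the only
    one for [U]. *)
Lemma context_unfold t p ch : context e t p D ->
  node_at t p = Some (Inner (Seq Sm D' (PVar U)) RUn ch) ->
  context e' t (p ++ [0]) D'.
Proof.
  intros (H1 & H2 & H3) Hp.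
  assert (Hpp : comp_at t p (Seq Sm D' (PVar U))) by (now exists ch).
  assert (Hq : forall q, comp_at t p q -> q = Seq Sm D' (PVar U)).
  { intros q [ch' Hc]; rewrite Hp in Hc; now injection Hc. }
  assert (Hnew : forall m q, strict_prefix m p -> comp_at t m q -> sF q <> PVar U).
  { intros m q Hm Hc HF; destruct (H3 m q Hm Hc) as (y & Hy & HF').
    rewrite HF in HF'; injection HF' as <-; now apply (proj1 U_fresh). }
  split; [|split].
  - intros y Hy; apply in_dom_snoc in Hy; destruct Hy as [Hy| ->].
    + destruct (H1 y Hy) as (m & q & Hm & Hc & HF & HS).
      exists m, q; split; [apply strict_prefix_child; now right|].
      do 2 (split; [trivial|]); intros w s; rewrite env_old by trivial; apply HS.
    + exists p, (Seq Sm D' (PVar U)); split; [apply strict_prefix_child; now left|].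
      do 2 (split; [trivial|]); intros w s; unfold e'; rewrite upd_eq; cbn; now exists w.
  - intros y m m' q q' Hm Hm' Hc Hc' HF HF'.
    apply strict_prefix_child in Hm, Hm'.
    destruct Hm as [->|Hm], Hm' as [->|Hm']; trivial.
    + rewrite (Hq q Hc) in HF; injection HF as <-; now destruct (Hnew m' q' Hm' Hc').
    + rewrite (Hq q' Hc') in HF'; injection HF' as <-; now destruct (Hnew m q Hm Hc).
    + exact (H2 y m m' q q' Hm Hm' Hc Hc' HF HF').
  - intros m q Hm Hc; apply strict_prefix_child in Hm; destruct Hm as [->|Hm].
    + exists U; split; [apply in_dom_snoc; now right|now rewrite (Hq q Hc)].
    + destruct (H3 m q Hm Hc) as (y & Hy & HF); exists y; split; trivial.
      apply in_dom_snoc; now left.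
Qed.

(** Leaves labelled [U] are settled here; those of older constants are handed upwards with their
    ranks projected by [pi]. Hence the index [D], although the sequent already carries [D']. *)
Lemma solves_unfold : solves lt e D (fun w s => exists v, rle lt (pi v) w /\ X v s)
  (Seq Sm D' (PVar U)).
Proof.
  destruct body as (Tb & HTq & HTok & HTt).
  assert (Hlook : dlook D' U = Some phi) by (apply dlook_snoc_new, U_fresh).
  exists (Inner (Seq Sm D' (PVar U)) RUn [Tb]); split; [trivial|split].
  { apply ok_tree_inner; [|exact (Forall_cons _ HTok (Forall_nil _))].
    split; [apply U_ok|]; exists U, z, a, (Seq Sm D' (psubst z U a)); cbn.
    rewrite HTq, Hlook; repeat split; trivial.
    destruct phi_fix as [-> | ->]; auto. }
  intros t p Hp Hctx.
  assert (Hp0 : node_at t (p ++ [0]) = Some Tb) by (exact (node_at_child (i := 0) Hp eq_refl)).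
  destruct (HTt t (p ++ [0]) Hp0 (context_unfold Hctx Hp)) as [HL HR].
  (* One pass through the body: [X_unfold] supplies the drop, and the invariant of the body
     preserves it. *)
  assert (Hstep : forall n q y s s' w, node_at t n = Some (Leaf q) -> sF q = PVar y ->
    In y (dom D') -> ord tr t n s' p s -> X w s ->
    exists v, rle lt' v w /\ (phi = PMu z a -> lt' v w) /\ e' v y s').
  { intros n q y s s' w Hn HF Hy Ho Hw.
    assert (Hnp : n <> p) by (intros ->; rewrite Hp in Hn; easy).
    destruct (ord_step Ho Hnp) as (i & s'' & Hlt & Ho2).
    destruct Hlt as (i' & q1 & r1 & ch1 & T & Hi & Hp' & HTi & _ & _ & He).
    apply app_inj_tail in Hi; destruct Hi as [_ <-].
    rewrite Hp in Hp'; injection Hp' as <- <- <-; cbn in He; subst s''.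
    destruct i as [|i]; [|now destruct i].
    destruct (X_unfold Hw) as (v & Hv & Hv' & Hs).
    destruct (HR n q y s s' v Hn HF Hy Ho2 Hs) as (v' & Hvv & Hs').
    exists v'; split; [exact (rle_trans lt_wf' lt_total' Hvv Hv)|split; trivial].
    intro E; exact (rle_lt_trans lt_wf' lt_total' Hvv (Hv' E)). }
  (* A companion leaf of [p] carries [U], which [e' v] interprets by [X v], so the next round starts
     with rank [v]. *)
  assert (Hcyc : forall s' s w, cyc tr t p s' s -> X w s ->
    exists v, rle lt' v w /\ (phi = PMu z a -> lt' v w) /\ X v s').
  { intros s' s w Hc Hw; destruct Hc as [m n s' s Hcl _ Ho].
    destruct Hcl as [(_ & _ & q & c & Hn & Hc & HF & _) _].
    rewrite Hp in Hc; injection Hc as <-; cbn in HF.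
    destruct (Hstep n q U s s' w) as (v & H1 & H2 & H3); auto.
    { apply in_dom_snoc; now right. }
    exists v; do 2 (split; trivial); unfold e' in H3; now rewrite upd_eq in H3. }
  assert (Hcycp : forall m s' s, cycp tr t m s' s -> m = p -> forall w, X w s ->
    exists v, rle lt' v w /\ X v s').
  { intros m s' s Hc; induction Hc as [m s' s Hc|m s' u s Hc _ IH]; intros -> w Hw.
    - destruct (Hcyc s' s w Hc Hw) as (v & H1 & _ & H2); now exists v.
    - destruct (IH eq_refl w Hw) as (v & H1 & H2).
      destruct (Hcyc s' u v Hc H2) as (v' & H3 & _ & H4); exists v'; split; trivial.
      exact (rle_trans lt_wf' lt_total' H3 H1). }
  assert (Hwf : phi = PMu z a -> well_founded (cyc tr t p)).
  { intros E; assert (Hacc : forall w s, X w s -> Acc (cyc tr t p) s).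
    { intro w; induction (lt_wf' w) as [w _ IH]; intros s Hs; constructor; intros s' Hc.
      destruct (Hcyc s' s w Hc Hs) as (v & _ & Hv & Hs'); eauto. }
    (* A state outside [Sm] has no predecessor, since [cyc] relates only states of the node. *)
    intro s; destruct (classic (Sm s)) as [[w Hw]|Hs]; [exact (Hacc w s Hw)|].
    constructor; intros s' Hc; destruct Hs; destruct Hc as [m n s' s _ _ Ho].
    destruct (ord_Sn Ho) as [_ [c [Hc Hs]]]; rewrite Hp in Hc; now injection Hc as <-. }
  split.
  - intros [|[|k0] k] q'; cbn; [easy| |now destruct k0].
    intros Hk; specialize (HL k q' Hk); rewrite <- app_assoc in HL; cbn in HL.
    destruct HL as [HL1 HL2]; split; trivial.
    destruct HL2 as [HL2|(y & HF & Hy & Hlk & Hcl)]; [now left|].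
    destruct (Nat.eq_dec y U) as [->|HyU].
    + left; rewrite Hlook in Hlk; right; right; destruct phi_fix as [E|E].
      * left; exists U, z, a; now rewrite <- E.
      * right; exists U, z, a; rewrite <- E; do 2 (split; trivial).
        exists p; split; [|auto]; apply (Hcl p (Seq Sm D' (PVar U))); trivial.
        -- apply strict_prefix_child; now left.
        -- now exists [Tb].
    + right; apply in_dom_snoc in Hy; destruct Hy as [Hy|Hy]; [|easy].
      exists y; do 2 (split; [trivial|]); split.
      * rewrite Hlk; now apply dlook_snoc_old.
      * intros m q Hm; apply Hcl; apply strict_prefix_child; now right.
  - intros n q y s s' w Hn HF Hy Hord (v & Hv & Hs).
    (* Loops at [p] are absorbed first: they lead from [s] to a state [u] of no larger rank in
       [W']. *)
    assert (Ho : exists u v', ord tr t n s' p u /\ rle lt' v' v /\ X v' u).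
    { destruct Hord as [Ho|(u & _ & _ & Hc & Ho)].
      - exists s, v; repeat split; trivial; now right.
      - destruct (Hcycp p u s Hc eq_refl v Hs) as (v' & H1 & H2); now exists u, v'. }
    destruct Ho as (u & v' & Ho & Hv' & Hu).
    destruct (Hstep n q y u s' v') as (v2 & H1 & _ & H2); trivial.
    { apply in_dom_snoc; now left. }
    rewrite env_old in H2 by trivial; exists (pi v2); split; trivial.
    apply (rle_trans lt_wf lt_total (v := pi v)); trivial.
    apply pi_mono, (rle_trans lt_wf' lt_total' H1 Hv').
Qed.

(** Loops may return to any state of an approximant, so [S] is first thinned to [Sm] and only then
    is the constant introduced. *)
Lemma solves_fix S : (forall w s, psem tr (e w) phi s -> exists v, rle lt (pi v) w /\ X v s) ->
  (forall s, S s -> Sm s) ->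
  solves lt e D (fun w => psem tr (e w) phi) (Seq S D phi).
Proof.
  intros Hlift HS.
  pose (G w s := exists v, rle lt (pi v) w /\ X v s).
  assert (HSig : solves lt e D G (Seq Sm D phi)).
  { apply (solves_inner lt_wf lt_total (r := RSig) (cs := [(Seq Sm D' (PVar U), G)]));
      [apply phi_ok|easy| | |].
    - exists z, a, U, (Seq Sm D' (PVar U)); cbn.
      split; [exact phi_fix|split; [trivial|split; [exact U_fresh|now repeat split]]].
    - constructor; [apply solves_unfold|constructor].
    - intros [|i] c s s'' w; cbn; [|now destruct i].
      intros [= <-] _ _ -> HG; exists w; split; [now right|trivial]. }
  apply (solves_inner lt_wf lt_total (r := RThin) (cs := [(Seq Sm D phi, G)]));
    [apply phi_ok|easy| | |].
  - exists (Seq Sm D phi); cbn; repeat split; trivial.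
  - constructor; [exact HSig|constructor].
  - intros [|i] c s s'' w; cbn; [|now destruct i].
    intros [= <-] _ _ -> HG; exists w; split; [now right|exact (Hlift w s HG)].
Qed.
End Unfolding.

(** * Ranks extended by the stages of a least fixpoint *)

Section Lexicographic.
Variables (W : Type) (lt : W -> W -> Prop) (F : W -> (St -> Prop) -> St -> Prop).
Hypothesis lt_wf : well_founded lt.
Hypothesis lt_total : forall v w, rle lt v w \/ lt w v.
Hypothesis F_mono : forall w A B, incl_set A B -> incl_set (F w A) (F w B).

(** The operator depends on the outer rank, and with it the tower from which the second component is
    drawn. *)
Definition stage := { p : W * (St -> Prop) | tower (F (fst p)) (snd p) }.

Definition stage_lt (p q : stage) : Prop :=
  lt (fst (proj1_sig p)) (fst (proj1_sig q)) \/
  (fst (proj1_sig p) = fst (proj1_sig q) /\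
   proper_incl (snd (proj1_sig p)) (snd (proj1_sig q))).

Lemma stage_lt_wf : well_founded stage_lt.
Proof.
  assert (H : forall w A (HA : tower (F w) A),
    Acc stage_lt (exist (fun p => tower (F (fst p)) (snd p)) (w, A) HA)).
  { intro w; induction (lt_wf w) as [w _ IHw]; intros A HA.
    assert (HAcc := tower_acc (F_mono (w := w)) HA); revert HA.
    induction HAcc as [A _ IHA]; intros HA; constructor.
    intros [[v B] HB] [H|[H1 H2]]; cbn in *; [now apply IHw|].
    subst v; now apply IHA. }
  intros [[w A] HA]; apply H.
Qed.

Lemma stage_lt_total p q : rle stage_lt p q \/ stage_lt q p.
Proof.
  destruct p as [[v A] HA], q as [[w B] HB]; unfold rle, stage_lt; cbn in *.
  destruct (lt_total v w) as [[H| ->]|H]; [now left; left; left| |now right; left].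
  destruct (classic (A = B)) as [->|HAB].
  (* Stages with equal components also carry equal tower proofs, so totality holds up to plain
     equality. *)
  - left; right; now rewrite (proof_irrelevance _ HA HB).
  - destruct (tower_total (F_mono (w := w)) HA HB) as [H|H].
    + left; left; right; repeat split; trivial.
      intro H'; exact (HAB (incl_set_antisym H H')).
    + right; right; repeat split; trivial.
      intro H'; exact (HAB (incl_set_antisym H' H)).
Qed.
End Lexicographic.

(** The rank type and the environments are quantified inside, because the case of [PMu] applies the
    induction hypothesis to [stage]. *)
Definition complete (n : nat) : Prop :=
  forall (a : pform Act), psize a < n ->
  forall (W : Type) (lt : W -> W -> Prop) (e : W -> nat -> St -> Prop)
    (D : deflist Act) (S : St -> Prop),
  well_founded lt -> (forall v w, rle lt v w \/ lt w v) ->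
  (forall z, ~ In z (dom D) -> forall w, e w z = V z) ->
  seq_ok (Seq S D a) -> (forall s, S s -> exists w, psem tr (e w) a s) ->
  solves lt e D (fun w => psem tr (e w) a) (Seq S D a).

Lemma seq_ok_sub S S' (D : deflist Act) a b : seq_ok (@Seq St _ S D a) ->
  wf (embed b) -> (forall U, pnegfree U b -> pnegfree U a) ->
  (forall U, pbound U b -> pbound U a) -> seq_ok (@Seq St _ S' D b).
Proof.
  intros (H1 & H2 & H3) Hb Hn Hp; split; [trivial|split; trivial]; cbn in *.
  intros U HU; destruct (H3 U HU); split; auto.
Qed.

(** * Choice of witnesses, one connective at a time *)

Section Cases.
Variables (n : nat) (W : Type) (lt : W -> W -> Prop) (e : W -> nat -> St -> Prop)
  (D : deflist Act) (S : St -> Prop).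
Hypothesis IH : complete n.
Hypothesis lt_wf : well_founded lt.
Hypothesis lt_total : forall v w, rle lt v w \/ lt w v.
Hypothesis e_free : forall z, ~ In z (dom D) -> forall w, e w z = V z.

Definition least_sat a s w := psem tr (e w) a s /\ forall v, psem tr (e v) a s -> rle lt w v.

Lemma least_sat_ex a : (forall s, S s -> exists w, psem tr (e w) a s) ->
  forall s, S s -> exists w, least_sat a s w.
Proof. intros H s Hs; exact (least_rank lt_wf lt_total (H s Hs)). Qed.

(** Every state of a child is reached by an edge from some state of [S], and edges transport
    satisfaction without raising the rank; so the children again satisfy their formulas. *)
Lemma solves_rule a r cs : seq_ok (Seq S D a) -> r <> RUn ->
  (forall s, S s -> exists w, psem tr (e w) a s) ->
  rule_ok tr (Seq S D a) r cs ->
  Forall (fun c => sD c = D /\ wf (embed (sF c)) /\ psize (sF c) < n /\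
    (forall U, pnegfree U (sF c) -> pnegfree U a) /\
    (forall U, pbound U (sF c) -> pbound U a)) cs ->
  (forall i c s'', nth_error cs i = Some c -> sS c s'' ->
    exists s, S s /\ edge (Seq S D a) r i s'' s) ->
  (forall i c s s'' w, nth_error cs i = Some c -> S s -> sS c s'' ->
    edge (Seq S D a) r i s'' s -> psem tr (e w) a s ->
    exists w', rle lt w' w /\ psem tr (e w') (sF c) s'') ->
  solves lt e D (fun w => psem tr (e w) a) (Seq S D a).
Proof.
  intros Ha Hr HS Hrule Hcs Hcover Hdec.
  apply (solves_inner lt_wf lt_total (r := r)
    (cs := map (fun c => (c, fun w => psem tr (e w) (sF c))) cs)); trivial.
  - now rewrite map_map, map_id.
  - apply Forall_forall; intros c Hc; apply in_map_iff in Hc.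
    destruct Hc as (c' & <- & Hc); cbn.
    rewrite Forall_forall in Hcs; destruct (Hcs c' Hc) as (HD & H1 & H2 & H3 & H4).
    destruct (In_nth_error _ _ Hc) as [i Hi].
    destruct c' as [S' D1 b]; cbn in *; subst D1.
    apply (IH H2); trivial; [exact (seq_ok_sub S' Ha H1 H3 H4)|].
    intros s'' Hs''; destruct (Hcover i _ s'' Hi Hs'') as (s & Hs & He).
    destruct (HS s Hs) as [w Hw].
    destruct (Hdec i _ s s'' w Hi Hs Hs'' He Hw) as (w' & _ & Hw'); now exists w'.
  - intros i c s s'' w Hi; rewrite nth_error_map in Hi.
    destruct (nth_error cs i) as [c'|] eqn:E; [|easy].
    injection Hi as <-; cbn; now apply Hdec.
Qed.

Ltac subformulas := repeat (apply Forall_cons || apply Forall_nil); cbn in *;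
  repeat split; try lia; intros; tauto.

Lemma solves_and a b : seq_ok (Seq S D (PAnd a b)) -> psize (PAnd a b) <= n ->
  (forall s, S s -> exists w, psem tr (e w) (PAnd a b) s) ->
  solves lt e D (fun w => psem tr (e w) (PAnd a b)) (Seq S D (PAnd a b)).
Proof.
  intros Hok Hn HS; assert (Hw := proj1 (proj2 Hok)).
  apply (@solves_rule _ RAnd [Seq S D a; Seq S D b]); trivial; try easy.
  - exists a, b, (Seq S D a), (Seq S D b); now repeat split.
  - subformulas.
  - intros [|[|i]] c s''; cbn; [| |now destruct i]; intros [= <-] H; now exists s''.
  - intros [|[|i]] c s s'' w; cbn; [| |now destruct i];
      intros [= <-] _ _ -> [H1 H2]; exists w; split; trivial; now right.
Qed.

Lemma solves_or a b : seq_ok (Seq S D (POr a b)) -> psize (POr a b) <= n ->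
  (forall s, S s -> exists w, psem tr (e w) (POr a b) s) ->
  solves lt e D (fun w => psem tr (e w) (POr a b)) (Seq S D (POr a b)).
Proof.
  intros Hok Hn HS; assert (Hw := proj1 (proj2 Hok)).
  (* A state goes to the disjuncts true at its signature, so its rank in the child is at most any
     rank at which the disjunction holds. *)
  pose (Sc c s := S s /\ exists w, least_sat (POr a b) s w /\ psem tr (e w) c s).
  apply (@solves_rule _ ROr [Seq (Sc a) D a; Seq (Sc b) D b]); trivial; try easy.
  - exists a, b, (Seq (Sc a) D a), (Seq (Sc b) D b); repeat split.
    + intros Hs; destruct (least_sat_ex HS Hs) as [w Hl].
      destruct (proj1 Hl) as [H|H]; [left|right]; split; trivial; now exists w.
    + now intros [[]|[]].
  - subformulas.
  - intros [|[|i]] c s''; cbn; [| |now destruct i];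
      intros [= <-] [H _]; now exists s''.
  - intros [|[|i]] c s s'' w; cbn; [| |now destruct i];
      intros [= <-] _ (_ & w' & Hl & H) -> Hs; exists w'; split; trivial; now apply Hl.
Qed.

Lemma solves_box K a : seq_ok (Seq S D (PBox K a)) -> psize (PBox K a) <= n ->
  (forall s, S s -> exists w, psem tr (e w) (PBox K a) s) ->
  solves lt e D (fun w => psem tr (e w) (PBox K a)) (Seq S D (PBox K a)).
Proof.
  intros Hok Hn HS; assert (Hw := proj1 (proj2 Hok)).
  pose (c := Seq (fun s' => exists s l, S s /\ K l /\ tr s l s') D a).
  apply (@solves_rule _ RBox [c]); trivial; try easy.
  - exists K, a, c; now repeat split.
  - subformulas.
  - intros [|i] c' s''; cbn; [|now destruct i]; intros [= <-] (s & l & Hs & Hl & Ht).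
    exists s; split; trivial; exists K, a; split; trivial; now exists l.
  - intros [|i] c' s s'' w; cbn; [|now destruct i].
    intros [= <-] _ _ (K' & a' & [= <- <-] & l & Hl & Ht) Hbox.
    exists w; split; [now right|exact (Hbox l s'' Hl Ht)].
Qed.

Lemma solves_dia K a : seq_ok (Seq S D (PDia K a)) -> psize (PDia K a) <= n ->
  (forall s, S s -> exists w, psem tr (e w) (PDia K a) s) ->
  solves lt e D (fun w => psem tr (e w) (PDia K a)) (Seq S D (PDia K a)).
Proof.
  intros Hok Hn HS; assert (Hw := proj1 (proj2 Hok)).
  (* The successor depends on the signature of [s] alone, hence serves every rank [w] at once. *)
  assert (Hf : forall s, exists s', S s -> exists w l,
    least_sat (PDia K a) s w /\ K l /\ tr s l s' /\ psem tr (e w) a s').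
  { intro s; destruct (classic (S s)) as [Hs|Hs]; [|now exists s].
    destruct (least_sat_ex HS Hs) as [w Hl].
    destruct (proj1 Hl) as (l & s' & H1 & H2 & H3); exists s'; intros _; now exists w, l. }
  apply functional_choice in Hf; destruct Hf as [f Hf].
  pose (c := Seq (fun s' => exists s, S s /\ s' = f s) D a).
  apply (@solves_rule _ (RDia f) [c]); trivial; try easy.
  - exists K, a, c; repeat split; trivial.
    intros s Hs; destruct (Hf s Hs) as (w & l & H); now exists l.
  - subformulas.
  - intros [|i] c' s''; cbn; [|now destruct i]; intros [= <-] H; exact H.
  - intros [|i] c' s s'' w; cbn; [|now destruct i].
    intros [= <-] Hs _ -> H; destruct (Hf s Hs) as (w' & l & H1 & _ & _ & H2).
    exists w'; split; trivial; now apply H1.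
Qed.

Lemma solves_ex a b : seq_ok (Seq S D (PEx a b)) -> psize (PEx a b) <= n ->
  (forall s, S s -> exists w, psem tr (e w) (PEx a b) s) ->
  solves lt e D (fun w => psem tr (e w) (PEx a b)) (Seq S D (PEx a b)).
Proof.
  intros Hok Hn HS; assert (Hw := proj1 (proj2 Hok)).
  assert (Hdet := proj1 (proj2 (proj2 HT))).
  assert (Hf : forall s, exists d, S s -> exists w s',
    least_sat (PEx a b) s w /\ tr s (Dl d) s' /\ psem tr (e w) b s' /\
    forall d' s'', (d' < d)%R -> tr s (Dl d') s'' -> psem tr (e w) a s'').
  { intro s; destruct (classic (S s)) as [Hs|Hs]; [|now exists 0%R].
    destruct (least_sat_ex HS Hs) as [w Hl].
    destruct (proj1 Hl) as (d & s' & H); exists d; intros _; exists w, s'; tauto. }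
  apply functional_choice in Hf; destruct Hf as [f Hf].
  pose (c1 := Seq (fun t => exists s d, S s /\ (d < f s)%R /\ tr s (Dl d) t) D a).
  pose (c2 := Seq (fun t => exists s, S s /\ tr s (Dl (f s)) t) D b).
  apply (@solves_rule _ (REx f) [c1; c2]); trivial; try easy.
  - exists a, b, c1, c2; repeat split; trivial.
    intros s Hs; destruct (Hf s Hs) as (w & s' & H); now exists s'.
  - subformulas.
  - intros [|[|i]] c s''; cbn; [| |now destruct i]; intros [= <-].
    + intros (s & d & Hs & Hd & Ht); exists s; split; trivial; left; eauto.
    + intros (s & Hs & Ht); exists s; auto.
  - intros [|[|i]] c s s'' w; cbn; [| |now destruct i]; intros [= <-] Hs _ He H;
      destruct (Hf s Hs) as (w' & s' & H1 & H2 & H3 & H4); exists w';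
      (split; [now apply H1|]); destruct He as [[Hi He]|[Hi He]]; try easy.
    + destruct He as (d & Hd & Ht); exact (H4 d s'' Hd Ht).
    (* Determinism of delays identifies [s''] with the state for which [b] was secured. *)
    + rewrite <- (Hdet s s' s'' (f s) (proj1 HT _ _ _ H2) H2 He); exact H3.
Qed.

Lemma solves_all a b : seq_ok (Seq S D (PAll a b)) -> psize (PAll a b) <= n ->
  (forall s, S s -> exists w, psem tr (e w) (PAll a b) s) ->
  solves lt e D (fun w => psem tr (e w) (PAll a b)) (Seq S D (PAll a b)).
Proof.
  intros Hok Hn HS; assert (Hw := proj1 (proj2 Hok)).
  assert (Hdet := proj1 (proj2 (proj2 HT))).
  (* Choice is applied to pairs of state and delay. The value [d] itself sends the end state to the
     second premise; a smaller value sends an earlier state satisfying [a] to the first. *)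
  assert (Hf : forall sd : St * R, exists d', forall s', S (fst sd) ->
    tr (fst sd) (Dl (snd sd)) s' ->
    exists w, least_sat (PAll a b) (fst sd) w /\
      ((d' = snd sd /\ psem tr (e w) b s') \/
       ((d' < snd sd)%R /\ exists s'', tr (fst sd) (Dl d') s'' /\ psem tr (e w) a s''))).
  { intros [s d]; cbn.
    destruct (classic (S s /\ exists s', tr s (Dl d) s')) as [[Hs [s' Ht]]|Hs].
    2: { exists 0%R; intros s' H1 H2; destruct Hs; eauto. }
    destruct (least_sat_ex HS Hs) as [w Hl].
    destruct (proj1 Hl d s' Ht) as [H|(d' & s'' & H1 & H2 & H3)].
    - exists d; intros s1 _ Ht1; exists w; split; trivial; left; split; trivial.
      rewrite <- (Hdet s s' s1 d (proj1 HT _ _ _ Ht) Ht Ht1); exact H.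
    - exists d'; intros s1 _ Ht1; exists w; split; trivial; right; split; trivial.
      now exists s''. }
  apply functional_choice in Hf; destruct Hf as [g' Hg'].
  pose (g s d := g' (s, d)).
  assert (Hg := fun s d => Hg' (s, d)); cbn in Hg; fold (g) in Hg.
  pose (c1 := Seq (fun t => exists s d s', S s /\ tr s (Dl d) s' /\
                 (g s d < d)%R /\ tr s (Dl (g s d)) t) D a).
  pose (c2 := Seq (fun t => exists s d s', S s /\ tr s (Dl d) s' /\
                 g s d = d /\ tr s (Dl (g s d)) t) D b).
  apply (@solves_rule _ (RAll g) [c1; c2]); trivial; try easy.
  - exists a, b, c1, c2; do 2 (split; [trivial|]); split; [|now repeat split].
    intros s d s' Hs Ht; destruct (Hg s d s' Hs Ht) as (w & _ & [[H _]|[H (s'' & Ht' & _)]]).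
    + fold (g s d) in H; rewrite H; split; [exact (proj1 HT _ _ _ Ht)|apply Rle_refl].
    + split; [exact (proj1 HT _ _ _ Ht')|now apply Rlt_le].
  - subformulas.
  - intros [|[|i]] c s''; cbn; [| |now destruct i]; intros [= <-];
      intros (s & d & s' & Hs & Hd & Hgd & Ht); exists s; split; trivial; exists d, s'; auto.
  - intros [|[|i]] c s s'' w; cbn; [| |now destruct i]; intros [= <-] Hs _ He H;
      destruct He as (d & s1 & Hd & Hi & Ht);
      destruct (Hg s d s1 Hs Hd) as (w' & Hl & Hw'); exists w';
      (split; [now apply Hl|]); fold (g s d) in Hw';
      destruct Hi as [[Hi Hgd]|[Hi Hgd]]; try easy.
    + destruct Hw' as [[E _]|[_ (s2 & Ht2 & H2)]]; [rewrite E in Hgd; lra|].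
      rewrite <- (Hdet s s2 s'' (g s d) (proj1 HT _ _ _ Ht) Ht2 Ht); exact H2.
    + destruct Hw' as [[_ H2]|[Hlt _]]; [|rewrite Hgd in Hlt; lra].
      rewrite Hgd in Ht; rewrite <- (Hdet s s1 s'' d (proj1 HT _ _ _ Hd) Hd Ht); exact H2.
Qed.

Lemma fresh_body U z a phi : phi = PNu z a \/ phi = PMu z a -> fresh U D phi ->
  z <> U /\ ~ pfree U a /\ ~ pbound U a.
Proof.
  unfold fresh, poccurs; intros [-> | ->] (_ & H & _); cbn in H; intuition.
Qed.

(** Positivity of [z] in the body is what makes [U] positive after the substitution. *)
Lemma seq_ok_unfold U z a phi (S' : St -> Prop) :
  phi = PNu z a \/ phi = PMu z a -> fresh U D phi -> seq_ok (Seq S D phi) ->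
  seq_ok (Seq S' (D ++ [(U, phi)]) (psubst z U a)) /\
  seq_ok (Seq S' (D ++ [(U, phi)]) (PVar U)).
Proof.
  intros Hphi HU (H1 & H2 & H3); cbn in *.
  assert (HD : dl_ok (D ++ [(U, phi)])).
  { apply dl_ok_snoc; trivial; intros y Hy; now apply H3. }
  assert (Hz : ~ pnegfree z a /\ wf (embed a)).
  { destruct Hphi as [-> | ->]; [now apply wf_embed_nu|now apply wf_embed_mu]. }
  destruct (fresh_body Hphi HU) as (HzU & HUf & HUb).
  assert (Hold : forall y, In y (dom D) -> ~ pnegfree y a /\ ~ pbound y a).
  { intros y Hy; destruct (H3 y Hy) as [H4 H5].
    destruct Hphi as [-> | ->]; cbn in H4, H5; tauto. }
  split; (split; [trivial|split]); cbn.
  - apply wf_psubst; tauto.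
  - intros y Hy; rewrite pbound_psubst.
    assert (Hn : pnegfree y (psubst z U a) -> pnegfree y a).
    { intro H; apply pnegfree_psubst in H; tauto. }
    unfold dom in Hy; rewrite map_app in Hy; apply in_app_iff in Hy.
    destruct Hy as [Hy|[<-|[]]]; [destruct (Hold y Hy); tauto|cbn in *].
    split; trivial; intro H; now apply HUf, pnegfree_pfree, Hn.
  - trivial.
  - tauto.
Qed.

Lemma psem_unfold U z a w X s : z <> U -> ~ pfree U a -> ~ pbound U a ->
  psem tr (upd (e w) U X) (psubst z U a) s <-> psem tr (upd (e w) z X) a s.
Proof.
  intros HzU HUf HUb; rewrite psem_psubst, upd_eq, upd_comm by (trivial; congruence).
  apply psem_agree; intros y Hy; apply upd_neq; now intros ->.
Qed.

Lemma env_snoc_free (W' : Type) (pi : W' -> W) (X : W' -> St -> Prop) U phi y :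
  ~ In y (dom (D ++ [(U, phi)])) -> forall w, upd (e (pi w)) U (X w) y = V y.
Proof.
  unfold dom; rewrite map_app, in_app_iff; cbn; intros Hy w.
  rewrite upd_neq by (intros ->; tauto); apply e_free; tauto.
Qed.

Lemma solves_nu z a : seq_ok (Seq S D (PNu z a)) -> psize (PNu z a) <= n ->
  (forall s, S s -> exists w, psem tr (e w) (PNu z a) s) ->
  solves lt e D (fun w => psem tr (e w) (PNu z a)) (Seq S D (PNu z a)).
Proof.
  intros Hok Hn HS; destruct (fresh_exists D (PNu z a)) as [U HU].
  assert (Hphi : PNu z a = PNu z a \/ PNu z a = PMu z a) by (now left).
  destruct (fresh_body Hphi HU) as (HzU & HUf & HUb).
  assert (Hz : ~ pnegfree z a) by (apply (wf_embed_nu z a), Hok).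
  (* No approximation from below: the ranks stay as they are, and [X w] is the whole greatest
     fixpoint, which is postfixed by monotonicity. *)
  pose (X w := psem tr (e w) (PNu z a)).
  assert (HX : forall w s, X w s -> psem tr (upd (e w) U (X w)) (psubst z U a) s).
  { intros w s (Y & Hs & HY); apply psem_unfold; trivial.
    apply (psem_mono Hz (X := Y)); [|exact (HY s Hs)].
    intros u Hu; now exists Y. }
  apply (@solves_fix W W lt lt e (fun w => w) X D U z a (PNu z a)); trivial.
  - intro S'; now apply (seq_ok_unfold (z := z) (a := a)).
  - intros w s Hs; exists w; split; [now right|split; [easy|exact (HX w s Hs)]].
  - apply IH; trivial.
    + rewrite psize_psubst; cbn in Hn; lia.
    + apply env_snoc_free.
    + now apply (seq_ok_unfold (z := z)).
    + intros s [w Hs]; exists w; exact (HX w s Hs).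
  - intros w s Hs; exists w; split; [now right|trivial].
Qed.

Lemma solves_mu z a : seq_ok (Seq S D (PMu z a)) -> psize (PMu z a) <= n ->
  (forall s, S s -> exists w, psem tr (e w) (PMu z a) s) ->
  solves lt e D (fun w => psem tr (e w) (PMu z a)) (Seq S D (PMu z a)).
Proof.
  intros Hok Hn HS; destruct (fresh_exists D (PMu z a)) as [U HU].
  assert (Hphi : PMu z a = PNu z a \/ PMu z a = PMu z a) by (now right).
  destruct (fresh_body Hphi HU) as (HzU & HUf & HUb).
  assert (Hz : ~ pnegfree z a) by (apply (wf_embed_mu z a), Hok).
  pose (F w X := psem tr (upd (e w) z X) a).
  assert (HF : forall w A B, incl_set A B -> incl_set (F w A) (F w B)).
  { intros w A B; now apply psem_mono. }
  pose (pi (p : stage F) := fst (proj1_sig p)).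
  pose (X (p : stage F) := snd (proj1_sig p)).
  assert (HX : forall p s, X p s -> exists q, stage_lt lt q p /\
    psem tr (upd (e (pi q)) U (X q)) (psubst z U a) s).
  { intros [[w A] HA] s Hs; cbn in *.
    (* The outer rank [w] is kept and the stage shrinks strictly, which is a drop in the
       lexicographic order. *)
    destruct (tower_pred (HF w) HA Hs) as (B & HB & HBA & HBs).
    exists (exist _ (w, B) HB); split; [now right|].
    now apply psem_unfold. }
  assert (Hlift : forall w s, psem tr (e w) (PMu z a) s -> exists p, rle lt (pi p) w /\ X p s).
  { intros w s Hs; destruct (lfp_tower (F := F w) Hs) as (A & HA & HAs).
    exists (exist _ (w, A) HA); split; [now right|trivial]. }
  apply (@solves_fix W (stage F) lt (stage_lt lt (F:=F)) e pi X D U z a (PMu z a)); trivial.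
  - now apply stage_lt_wf.
  - now apply stage_lt_total.
  - intros p q [[H|[H _]]| ->]; [now left|now right|now right].
  - intro S'; now apply (seq_ok_unfold (z := z) (a := a)).
  - intros p s Hs; destruct (HX p s Hs) as (q & Hq & H); exists q.
    split; [now left|now split].
  - apply IH.
    + rewrite psize_psubst; cbn in Hn; lia.
    + now apply stage_lt_wf.
    + now apply stage_lt_total.
    + apply env_snoc_free.
    + now apply (seq_ok_unfold (z := z)).
    + intros s [p Hs]; destruct (HX p s Hs) as (q & _ & H); now exists q.
  - intros s Hs; destruct (HS s Hs) as [w Hw].
    destruct (Hlift w s Hw) as (p & _ & Hp); now exists p.
Qed.
End Cases.

Lemma complete_all n : complete n.
Proof.
  induction n as [|n IH]; intros a Hn W lt e D S lt_wf lt_total e_free Hok HS; [lia|].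
  assert (Hle : psize a <= n) by lia; clear Hn; destruct a.
  - apply (solves_leaf lt (e := e) (q := Seq S D (PVar z))); trivial; exists z; auto.
  - apply (solves_leaf lt (e := e) (q := Seq S D (PNVar z))); trivial; exists z; auto.
  - now apply (solves_and IH).
  - now apply (solves_or IH).
  - now apply (solves_box IH).
  - now apply (solves_dia IH).
  - now apply (solves_all IH).
  - now apply (solves_ex IH).
  - now apply (solves_nu IH).
  - now apply (solves_mu IH).
Qed.
End Construction.

Theorem theorem7 (St Act : Type) (tr : St -> lab Act -> St -> Prop)
  (HT : is_TTS tr) (V : nat -> St -> Prop) (S : St -> Prop) (Phi : pform Act)
  (Hwf : wf (embed Phi))
  (HS : forall s, S s -> sem tr V (embed Phi) s) :
  exists t : tab St Act, is_tableau tr t S Phi /\ successful tr V t.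
Proof.
  (* Before any fixpoint is entered there is a single rank, whose environment is [V]. *)
  destruct (@complete_all St Act tr V HT _ Phi (Nat.lt_succ_diag_r _) unit
    (fun _ _ => False) (fun _ => V) [] S) as (t & Hq & Hok & Ht).
  - intro w; constructor; easy.
  - intros [] []; left; now right.
  - trivial.
  - split; [|split; [trivial|easy]]; split; [constructor|split; [easy|]].
    intros [|i]; easy.
  - intros s Hs; exists tt; now apply sem_embed, HS.
  - destruct (Ht t [] eq_refl) as [HL _].
    { split; [easy|split].
      - intros U m m' q q' [k [Hk H]]; now apply eq_sym, app_eq_nil in H as [_ ->].
      - intros m q [k [Hk H]]; now apply eq_sym, app_eq_nil in H as [_ ->]. }
    (* With the empty definition list no constant is pending above the root, so every leaf is
       already judged successful. *)
    exists t; split; [|intros p q Hp; destruct (HL p q Hp) as [_ [H|(U & _ & H & _)]]; [exact H|destruct H]].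
    unfold is_tableau; rewrite Hq; do 3 (split; [easy|]).
    split; [intros p c Hp; exact (proj1 (Hok p c Hp))|split].
    + intros p q r ch Hp; exact (proj2 (Hok p _ Hp)).
    + intros p q Hp; exact (proj1 (HL p q Hp)).
Qed.
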